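(* Let $\Gamma$ be a finite quiver with vertex set $\Gamma_0$ and arrow set $\Gamma_1$, let $\hat{\Gamma}$ be its universal abelian covering quiver, and let $\alpha\in\mathbb{Z}_{\geq 0}^{\Gamma_0}$ be a dimension vector. Then the value at one of the Kac polynomial of $(\Gamma,\alpha)$ is $$a_{\Gamma,\alpha}(1)=\sum_{\beta} a_{\hat{\Gamma},\beta}(1),$$ where the sum ranges over a complete system of representatives $\beta$ of the equivalence classes of dimension vectors of $\hat{\Gamma}$ that are compatible with $\alpha$.
   Context: A quiver $\Gamma$ has a finite set of vertices $\Gamma_0$ and a finite set of arrows $\Gamma_1$ (loops and multiple arrows allowed). A representation $M$ of $\Gamma$ over a field $k$ consists of finite-dimensional $k$-vector spaces $(M_i)_{i\in\Gamma_0}$ and linear maps $M_a:M_i\to M_j$ for each arrow $a:i\to j$; its dimension vector is $(\dim_k M_i)_i$. It is absolutely indecomposable if $M\otimes_k K$ is indecomposable for every finite extension $K|k$. Kac polynomial: the number of isomorphism classes of absolutely indecomposable representations of $\Gamma$ of dimension vector $\alpha$ over $\mathbb{F}_q$ is a polynomial in $q$ with integer coefficients (Kac), denoted $a_{\Gamma,\alpha}(q)$. For an infinite quiver and a finitely supported dimension vector $\beta$, $a_{\hat\Gamma,\beta}(q)$ is defined in the same way (equivalently, it is the Kac polynomial of the finite full subquiver on the support of $\beta$). Universal abelian covering quiver: $\hat{\Gamma}$ is the infinite quiver with $\hat{\Gamma}_0=\Gamma_0\times\mathbb{Z}^{\Gamma_1}$, $\hat{\Gamma}_1=\Gamma_1\times\mathbb{Z}^{\Gamma_1}$,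 where for an arrow $a:i\to j$ of $\Gamma$ and $\chi\in\mathbb{Z}^{\Gamma_1}$ the arrow $(a,\chi)$ goes from $(i,\chi)$ to $(j,\chi+e_a)$, $e_a$ being the unit vector of $\mathbb{Z}^{\Gamma_1}$ at $a$. A dimension vector of $\hat{\Gamma}$ is a finitely supported $\beta=(\beta_{i,\chi})\in\mathbb{Z}_{\ge 0}^{\hat{\Gamma}_0}$. It is compatible with $\alpha$ if $\sum_{\chi}\beta_{i,\chi}=\alpha_i$ for all $i\in\Gamma_0$. The group $\mathbb{Z}^{\Gamma_1}$ acts on finitely supported vectors by $(\xi.\beta)_{i,\chi}=\beta_{i,\chi+\xi}$; two dimension vectors are equivalent if they lie in the same $\mathbb{Z}^{\Gamma_1}$-orbit. Up to equivalence only finitely many dimension vectors with connected support are compatible with $\alpha$, and $a_{\hat\Gamma,\beta}=0$ if the support of $\beta$ is not connected, so the sum has only finitely many non-zero terms. *)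

(* Defs.v *)
From mathcomp Require Import all_boot all_order all_algebra all_field.
From mathcomp Require Import finmap.
From mathcomp Require Import boolp classical_sets functions cardinality fsbigop.

Set Implicit Arguments.
Unset Strict Implicit.
Unset Printing Implicit Defensive.

Import GRing.Theory Num.Theory.
Local Open Scope ring_scope.

(* [V] and [A] are arbitrary so that the same notions apply to a finite quiver
   ([V A : finType]) and to its infinite covering quiver. *)
Record quiver (V A : Type) := Quiver { src : A -> V; tgt : A -> V }.

Section Representations.
Variables (V A : Type) (G : quiver V A) (F : fieldType).
Implicit Types d e : V -> nat.

(* A representation on the spaces 'rV[F]_(d i).  Following the convention of
   the library, matrices act on row vectors from the right: M_a is the linear
   map v |-> v *m M a from 'rV_(d (src a)) to 'rV_(d (tgt a)). *)
Definition rep d := forall a : A, 'M[F]_(d (src G a), d (tgt G a)).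

Definition is_hom d e (M : rep d) (N : rep e)
    (f : forall i, 'M[F]_(d i, e i)) : Prop :=
  forall a, M a *m f (tgt G a) = f (src G a) *m N a.

Definition isomorphic d e (M : rep d) (N : rep e) : Prop :=
  exists (f : forall i, 'M[F]_(d i, e i)) (g : forall i, 'M[F]_(e i, d i)),
    [/\ is_hom M N f, is_hom N M g,
        forall i, f i *m g i = 1%:M & forall i, g i *m f i = 1%:M].

Definition dsum d e (M : rep d) (N : rep e) : rep (fun i => d i + e i)%N :=
  fun a => block_mx (M a) 0 0 (N a).

Definition indecomposable d (M : rep d) : Prop :=
  (exists i, d i <> 0%N) /\
  forall d1 d2 (M1 : rep d1) (M2 : rep d2), isomorphic M (dsum M1 M2) ->
    (forall i, d1 i = 0%N) \/ (forall i, d2 i = 0%N).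

End Representations.

Definition base_change (V A : Type) (G : quiver V A) (F : fieldType)
    (K : fieldExtType F) (d : V -> nat) (M : rep G F d) : rep G K d :=
  fun a => map_mx (in_alg K) (M a).

Definition abs_indecomposable (V A : Type) (G : quiver V A) (F : fieldType)
    (d : V -> nat) (M : rep G F d) : Prop :=
  forall K : fieldExtType F, indecomposable (base_change K M).

(* There are exactly [n] isomorphism classes of absolutely indecomposable
   representations of dimension vector [d]; the [r i] represent them. *)
Definition num_abs_indec (V A : Type) (G : quiver V A) (F : fieldType)
    (d : V -> nat) (n : nat) : Prop :=
  exists r : 'I_n -> rep G F d,
    [/\ forall i, abs_indecomposable (r i),
        forall i j, isomorphic (r i) (r j) -> i = j
      & forall M : rep G F d, abs_indecomposable M ->
          exists i, isomorphic M (r i)].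

(* [P] is the Kac polynomial of (G, d); it is unique, see [is_kac_poly_uniq]. *)
Definition is_kac_poly (V A : Type) (G : quiver V A) (d : V -> nat)
    (P : {poly int}) : Prop :=
  forall F : finFieldType,
    exists2 n : nat, num_abs_indec G F d n & P.[#|F|%:Z] = n%:Z.

Section Covering.
Variables V A : finType.

Local Notation lattice := {ffun A -> int}.

Definition unit_vec (a : A) : lattice := [ffun b => (b == a)%:Z].

Definition covering_quiver (G : quiver V A) : quiver (V * lattice) (A * lattice) :=
  Quiver (fun x => (src G x.1, x.2))
         (fun x => (tgt G x.1, x.2 + unit_vec x.1)).

Definition cov_dimvec := {fsfun V * lattice -> nat with 0%N}.

Definition compatible (alpha : V -> nat) (beta : cov_dimvec) : Prop :=
  forall i, (\sum_(x <- finsupp beta | x.1 == i) beta x)%N = alpha i.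

Definition translates (beta gamma : cov_dimvec) : Prop :=
  exists xi : lattice, forall i chi, gamma (i, chi) = beta (i, chi + xi).

Definition representatives (alpha : V -> nat) (R : set cov_dimvec) : Prop :=
  [/\ forall beta, R beta -> compatible alpha beta,
      forall beta, compatible alpha beta ->
        exists2 gamma, R gamma & translates beta gamma
    & forall beta gamma, R beta -> R gamma -> translates beta gamma ->
        beta = gamma].

End Covering.

Section Uniqueness.
Variables (V A : Type) (G : quiver V A).

Lemma isomorphic_sym (F : fieldType) (d e : V -> nat)
    (M : rep G F d) (N : rep G F e) : isomorphic M N -> isomorphic N M.
Proof. by case=> f [g [? ? ? ?]]; exists g, f; split. Qed.

Lemma isomorphic_trans (F : fieldType) (d1 d2 d3 : V -> nat)
    (M : rep G F d1) (N : rep G F d2) (L : rep G F d3) :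
  isomorphic M N -> isomorphic N L -> isomorphic M L.
Proof.
move=> [f [g [hf hg fg gf]]] [f' [g' [hf' hg' fg' gf']]].
exists (fun i => f i *m f' i), (fun i => g' i *m g i); split=> [a|a|i|i].
- by rewrite mulmxA hf -!mulmxA hf'.
- by rewrite mulmxA hg' -!mulmxA hg.
- by rewrite -mulmxA (mulmxA (f' i)) fg' mul1mx fg.
- by rewrite -mulmxA (mulmxA (g i)) gf mul1mx gf'.
Qed.

Lemma num_abs_indec_uniq (F : fieldType) (d : V -> nat) (m n : nat) :
  num_abs_indec G F d m -> num_abs_indec G F d n -> m = n.
Proof.
suff le_mn p q : num_abs_indec G F d p -> num_abs_indec G F d q -> (p <= q)%N.
  by move=> hm hn; apply/eqP; rewrite eqn_leq !le_mn.
move=> [r [r_ai r_inj _]] [s [_ _ s_all]].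
have [h hP] := choice (fun i => s_all (r i) (r_ai i)).
rewrite -(card_ord p) -(card_ord q); apply: (@leq_card _ _ h) => i j hij.
apply: r_inj; apply: isomorphic_trans (hP i) _.
by rewrite hij; apply: isomorphic_sym.
Qed.

Lemma is_kac_poly_uniq (d : V -> nat) (P Q : {poly int}) :
  is_kac_poly G d P -> is_kac_poly G d Q -> P = Q.
Proof.
move=> hP hQ; apply/eqP; rewrite -subr_eq0; apply/negPn/negP => nz.
pose s : seq int := [seq (2 ^ k.+1)%N%:Z | k <- iota 0 (size (P - Q)%R)].
suff: (size s < size (P - Q)%R)%N by rewrite size_map size_iota ltnn.
apply: max_poly_roots => //.
  apply/allP => _ /mapP[k _ ->].
  have [F _ cardF] := pPrimePowerField (isT : prime 2) (ltn0Sn k).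
  rewrite rootE !hornerE -cardF.
  have [m hm ->] := hP F; have [n hn ->] := hQ F.
  by rewrite (num_abs_indec_uniq hm hn) subrr.
rewrite map_inj_uniq ?iota_uniq // => i j [] /eqP.
by rewrite eqn_exp2l // => /eqP [].
Qed.

End Uniqueness.

(* Main.v *)
Require Import Defs.
From mathcomp Require Import all_boot all_order all_fingroup all_algebra.
From mathcomp Require Import all_solvable all_field.
From mathcomp Require Import finmap zify.
From mathcomp Require Import boolp classical_sets functions cardinality fsbigop.

(** Both sides are compared modulo arbitrarily large primes l.

Let n be the total dimension of alpha.  Fix a prime p > n, take a large prime l
and the field F with p ^ (l - 1) elements, so that l divides #|F| - 1.  For an
integral polynomial P this gives P(#|F|) = P(1) mod l, so that it is enough to
count isomorphism classes over F modulo l ([horner_int_congr]).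

Choose a primitive l-th root of unity zeta of F and give every arrow a the
weight t_a = zeta ^ (B ^ k), where k is the index of a and B = 2n + 1.  Scaling
M_a by t_a permutes the classes of absolutely indecomposable representations of
dimension vector alpha, and the l-th power of this permutation is the identity.
Hence the number of classes is congruent modulo l to the number of fixed
classes ([card_fix_perm_mod]), and the fixed classes are exactly the push-downs
of absolutely indecomposable representations of the covering quiver:

- A representation of the covering quiver is the same thing as a representation
  M of the quiver together with a grading of the spaces M_i by the lattice for
  which M_a has degree e_a ([grading], [piece], [grading_exists]).  Scaling the
  part of degree chi by the product of the t_a ^ chi_a is an isomorphism from M
  to its twist ([graded_twist_iso]).

- Let M be absolutely indecomposable and isomorphic to its twist.  The
  isomorphism can be normalised to f with f ^ l = 1 ([semi_endo_normalize]).  Its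
  eigenspaces grade M by the l-th roots of unity, M_a multiplying the eigenvalue
  by t_a.  Starting from one eigenvector and following arrows, one lifts this
  grading to the lattice: the degrees met stay in a box of size n, on which the
  weights are injective as l is large, and by indecomposability the part of M
  which is reached is all of M ([grading_lift], [fixed_grading]).

- The grading is unique up to a translation, and the graded pieces are unique
  up to isomorphism ([iso_graded_shift], [iso_pieces]); a push-down is
  absolutely indecomposable if and only if the representation of the covering
  quiver is ([tracial_piece], [tracial_of_piece]).

Absolute indecomposability is handled through traces.  As p > n, it is
equivalent to the multiplicativity of the normalised trace f |-> tr f / n on
End(M), a condition over F alone ([tracial], [abs_indecomposable_tracial],
[tracial_abs_indecomposable]).  In the graded situation the trace only sees
the parts of degree zero, and the composite of parts of opposite nonzero degrees
cannot be invertible because a nonzero translation leaves no nonempty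
finite set of degrees stable ([no_shift]); this gives the properties of push-downs.

The degrees being confined to a box, only finitely many translation classes of
dimension vectors contribute, uniformly in F ([finitely_many_shapes]).  So the
two sides of the identity are integers that are congruent modulo arbitrarily
large primes ([value_at_one_mod]). *)

Set Implicit Arguments.
Unset Strict Implicit.
Unset Printing Implicit Defensive.

Import GRing.Theory Num.Theory.
Local Open Scope ring_scope.

(** * Idempotents, nilpotents and powers of matrices *)

Section Matrices.
Variables (F : fieldType) (n : nat).
Implicit Types A B : 'M[F]_n.

Lemma row_col_base_idem A : A *m A = A -> row_base A *m col_base A = 1%:M.
Proof.
move=> idA; apply: (row_full_inj (col_base_full A)).
apply: (row_free_inj (row_base_free A)).
by rewrite mulmx1 mulmx_base mulmxA mulmx_base -mulmxA mulmx_base idA.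
Qed.

Lemma mxtrace_idem A : A *m A = A -> \tr A = (\rank A)%:R.
Proof.
move=> idA; rewrite -[in LHS](mulmx_base A) mxtrace_mulC row_col_base_idem //.
exact: mxtrace1.
Qed.

(** If [A ^+ m = 0] then ['X - A] divides ['X^m] as matrices, so the
characteristic polynomial of [A] divides a power of ['X] and is one. *)
Lemma mxtrace_nilp A m : A ^+ m = 0 -> \tr A = 0.
Proof.
case: n A => [|k] A Am0; first by rewrite /mxtrace big_ord0.
have dvd : char_poly A %| ('X - 0%:P) ^+ (m * k.+1).
  pose B : 'M[{poly F}]_k.+1 := map_mx polyC A.
  have Bm : B ^+ m = 0 by rewrite -rmorphXn /= Am0 rmorph0.
  have cXB : GRing.comm ('X%:M : 'M[{poly F}]_k.+1) B by exact: comm_scalar_mx.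
  have := subrXX_comm m cXB; rewrite Bm subr0 => defXm.
  rewrite subr0 exprM -det_scalar rmorphXn /= defXm.
  by rewrite -[char_poly A]/(\det ('X%:M - B)) [X in _ %| X]det_mulmx dvdp_mulIl.
have [j _] := dvdp_exp_XsubCP dvd.
rewrite eqp_monic ?char_poly_monic ?monic_exp ?monicXsubC // => /eqP defA.
have sz := size_char_poly A; have := char_poly_trace A (ltn0Sn k).
move: sz; rewrite defA subr0 size_polyXn => -[->].
by rewrite /= coefXn eqn_leq ltnn andbF => /esym/eqP; rewrite oppr_eq0 => /eqP.
Qed.

End Matrices.

Section FiniteMatrix.
Variable F : finFieldType.

Lemma exp_period n (A : 'M[F]_n) :
  exists i t, (0 < t)%N /\ A ^+ (i + t) = A ^+ i.
Proof.
pose f (k : 'I_#|{: 'M[F]_n}|.+1) : 'M[F]_n := A ^+ k.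
have [/injectiveP fi|/injectivePn [x [y nxy fxy]]] := boolP (injectiveb f).
  have := leq_card f fi; by rewrite card_ord ltnn.
wlog ltxy : x y nxy fxy / (x < y)%N.
  move=> W; have [lt|lt|/ord_inj e] := ltngtP x y; first exact: (W x y).
    by apply: (W y x); rewrite // eq_sym.
  by rewrite e eqxx in nxy.
exists x, (y - x)%N; rewrite subn_gt0 ltxy; split=> //.
by rewrite subnKC; [exact/esym | exact: ltnW].
Qed.

Lemma exp_idem_mul n (A : 'M[F]_n) m k : (0 < k)%N ->
  A ^+ m *m A ^+ m = A ^+ m -> A ^+ (m * k) = A ^+ m.
Proof.
move=> k0 id; case: k k0 => // k _.
elim: k => [|k IH]; first by rewrite muln1.
by rewrite mulnS exprD IH.
Qed.

(** In a finite monoid the powers of an element become periodic; a multiple of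
the period beyond the preperiod gives an idempotent. *)
Lemma exp_idem n (A : 'M[F]_n) :
  exists2 m, (0 < m)%N & A ^+ m *m A ^+ m = A ^+ m.
Proof.
have [i [t [t0 per]]] := exp_period A.
have per_k k j : A ^+ (i + j + k * t) = A ^+ (i + j).
  elim: k => [|k IH]; first by rewrite mul0n addn0.
  by rewrite mulSn addnACA exprD per -exprD addnA IH.
exists (i.+1 * t)%N; first by rewrite muln_gt0.
have le : (i <= i.+1 * t)%N by apply: leq_trans (leq_pmulr _ t0); apply: leqnSn.
rewrite -[_ *m _]/(_ * _) -exprD -{1 3}(subnKC le) per_k //.
Qed.

(** A common exponent for all vertices: the resulting family of idempotents
replaces the projector of the Fitting decomposition and, being a power, is an
endomorphism whenever [f] is one. *)
Lemma family_exp_idem (V : eqType) (d : V -> nat) (s : seq V)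
    (f : forall i, 'M[F]_(d i)) : exists2 m, (0 < m)%N &
  forall i, i \in s -> f i ^+ m *m f i ^+ m = f i ^+ m.
Proof.
elim: s => [|x s [m m0 IH]]; first by exists 1%N.
have [k k0 Hk] := exp_idem (f x).
exists (m * k)%N; first by rewrite muln_gt0 m0.
move=> i; rewrite inE => /orP[/eqP->|/IH idi].
  by rewrite mulnC !exp_idem_mul.
by rewrite !exp_idem_mul.
Qed.

End FiniteMatrix.

Lemma eq_mx_dim0 (F : fieldType) m n (B C : 'M[F]_(m, n)) : m = 0%N -> B = C.
Proof.
by move=> m0; apply/matrixP => x; have := ltn_ord x; rewrite [X in (_ < X)%N]m0.
Qed.

(** The rank is abstracted as [r], so that rewriting with [C i *m R i = h i] does
not change the dimensions of [C] and [R]. *)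
Lemma idem_split (F : fieldType) (T : Type) (d : T -> nat)
    (h : forall i, 'M[F]_(d i)) : (forall i, h i *m h i = h i) ->
  exists (r : T -> nat) (C : forall i, 'M[F]_(d i, r i))
         (R : forall i, 'M[F]_(r i, d i)),
    (forall i, C i *m R i = h i) /\ (forall i, R i *m C i = 1%:M).
Proof.
move=> idh; exists (fun i => \rank (h i)).
exists (fun i => col_base (h i)), (fun i => row_base (h i)).
by split=> i; [exact: mulmx_base | exact: row_col_base_idem].
Qed.

Lemma split_orth (F : fieldType) n m p (C : 'M[F]_(n, m)) (R : 'M_(m, n))
    (C' : 'M_(n, p)) (R' : 'M_(p, n)) :
  R *m C = 1%:M -> R' *m C' = 1%:M -> (C *m R) *m (C' *m R') = 0 -> R *m C' = 0.
Proof.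
move=> RC RC' /(congr1 (fun X => R *m X *m C')).
by rewrite mulmx0 mul0mx !mulmxA RC mul1mx -!mulmxA RC' mulmx1.
Qed.

(** [B] is the sum of a nonzero scalar and a nilpotent matrix. *)
Lemma unitmx_add_nilp (F : fieldType) n (B : 'M[F]_n) c m :
  c != 0 -> (B - c%:M) ^+ m = 0 -> B \in unitmx.
Proof.
case: n B => [|k] B c0 nilB; first by rewrite unitmxE det_mx00 unitr1.
have cBc : GRing.comm (B - c%:M) (- c%:M).
  by rewrite /GRing.comm mulrN mulNr; congr (- _); exact: scalar_mxC.
have := subrXX_comm m cBc; rewrite nilB sub0r opprK subrK => eqB.
have u : (- (- c%:M : 'M[F]_k.+1) ^+ m) \is a GRing.unit.
  rewrite unitrN unitrX // unitrN -[_ \is a _]/(_ \in unitmx) unitmxE det_scalar.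
  by rewrite unitrX ?unitfE.
by move: u; rewrite eqB -[_ \is a _]/(_ \in unitmx) unitmx_mul => /andP[].
Qed.

Lemma unitmx_exp (F : fieldType) n (B : 'M[F]_n) m :
  B \in unitmx -> B ^+ m \in unitmx.
Proof.
move=> uB; elim: m => [|m IH]; first exact: unitmx1.
by rewrite exprS -[_ * _]/(_ *m _) unitmx_mul uB.
Qed.

(** The row spaces of orthogonal idempotents are in direct sum. *)
Lemma mxrank_orth_add (F : fieldType) n (B C : 'M[F]_n) :
  B *m B = B -> C *m C = C -> B *m C = 0 -> C *m B = 0 ->
  \rank (B + C)%R = (\rank B + \rank C)%N.
Proof.
move=> idB idC BC CB.
rewrite -mxrank_disjoint_sum.
  apply/eqP; rewrite eqn_leq mxrankS ?addmx_sub_adds ?submx_refl //=.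
  apply: mxrankS; rewrite addsmx_sub.
  apply/andP; split; apply/submxP.
    by exists B; rewrite mulmxDr idB BC addr0.
  by exists C; rewrite mulmxDr idC CB add0r.
set D := (B :&: C)%MS.
have [X defX] : exists X, D = X *m B by apply/submxP; exact: capmxSl.
have [Y defY] : exists Y, D = Y *m C by apply/submxP; exact: capmxSr.
by rewrite defY -[in LHS]idC mulmxA -defY defX -mulmxA BC mulmx0.
Qed.

Lemma mxrank_orth_sum (F : fieldType) n (I : eqType) (r : seq I)
    (e : I -> 'M[F]_n) : uniq r ->
  (forall i, i \in r -> e i *m e i = e i) ->
  (forall i j, i \in r -> j \in r -> i != j -> e i *m e j = 0) ->
  \rank (\sum_(i <- r) e i)%R = (\sum_(i <- r) \rank (e i))%N.
Proof.
move=> ur ide orth.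
suff: (\sum_(i <- r) e i) *m (\sum_(i <- r) e i) = \sum_(i <- r) e i /\
  \rank (\sum_(i <- r) e i)%R = (\sum_(i <- r) \rank (e i))%N by case.
elim: r ur ide orth => [|x r IH] /=; first by rewrite !big_nil mul0mx mxrank0.
case/andP=> nxr ur ide orth; rewrite !big_cons.
have [|i j ir jr|id rk] := IH ur.
- by move=> i ir; apply: ide; rewrite inE ir orbT.
- by apply: orth; rewrite inE ?ir ?jr orbT.
have x0 : e x *m (\sum_(i <- r) e i) = 0.
  rewrite mulmx_sumr big_seq big1 // => i ir.
  by rewrite orth ?inE ?eqxx ?ir ?orbT //; apply: contraNneq nxr => ->.
have z0x : (\sum_(i <- r) e i) *m e x = 0.
  rewrite mulmx_suml big_seq big1 // => i ir.
  by rewrite orth ?inE ?eqxx ?ir ?orbT //; apply: contraNneq nxr => <-.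
have idx : e x *m e x = e x by apply: ide; rewrite inE eqxx.
rewrite mxrank_orth_add // rk; split=> //.
by rewrite mulmxDl !mulmxDr idx x0 z0x id addr0 add0r.
Qed.

Lemma scalar_mx_exp (F : fieldType) n (c : F) m : (c%:M : 'M[F]_n) ^+ m = (c ^+ m)%:M.
Proof.
elim: m => [|m IH]; first by rewrite !expr0.
by rewrite !exprS scalar_mxM -IH.
Qed.

Lemma map_mx_exp (F K : fieldType) (u : {rmorphism F -> K}) n (B : 'M[F]_n) m :
  map_mx u (B ^+ m) = map_mx u B ^+ m.
Proof.
elim: m => [|m IH]; first by rewrite map_mx1.
by rewrite !exprS -[_ * _]/(_ *m _) map_mxM IH.
Qed.

(** * Homomorphisms and direct summands *)

Lemma is_hom_comp (V A : Type) (G : quiver V A) (F : fieldType)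
    (d1 d2 d3 : V -> nat) (M1 : rep G F d1) (M2 : rep G F d2) (M3 : rep G F d3)
    f g : is_hom M1 M2 f -> is_hom M2 M3 g -> is_hom M1 M3 (fun i => f i *m g i).
Proof. by move=> hf hg a; rewrite mulmxA hf -mulmxA hg mulmxA. Qed.

Lemma isomorphic_refl (V A : Type) (G : quiver V A) (F : fieldType) (d : V -> nat)
  (M : rep G F d) : isomorphic M M.
Proof.
exists (fun=> 1%:M), (fun=> 1%:M); split=> [a|a|i|i]; rewrite ?mulmx1 ?mul1mx //.
Qed.

Section Endomorphisms.
Variables (V : eqType) (A : Type) (G : quiver V A) (F : fieldType) (d : V -> nat).
Variable M : rep G F d.
Implicit Types f g h e : forall i, 'M[F]_(d i).

Lemma is_hom_scalar c : is_hom M M (fun i => c%:M).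
Proof. by move=> a; rewrite scalar_mxC. Qed.

Lemma is_hom_add f g : is_hom M M f -> is_hom M M g ->
  is_hom M M (fun i => f i + g i).
Proof. by move=> hf hg a; rewrite mulmxDr mulmxDl hf hg. Qed.

Lemma is_hom_opp f : is_hom M M f -> is_hom M M (fun i => - f i).
Proof. by move=> hf a; rewrite mulmxN mulNmx hf. Qed.

Lemma is_hom_exp f m : is_hom M M f -> is_hom M M (fun i => f i ^+ m).
Proof.
move=> hf a; elim: m => [|m IH]; first by rewrite mulmx1 mul1mx.
by rewrite !exprS -[_ * _]/(_ *m _) mulmxA hf -mulmxA IH mulmxA.
Qed.

(** An idempotent endomorphism splits off its image, with complement the image
of [1 - e]. *)
Lemma indecomposable_idem e : indecomposable M -> is_hom M M e ->
  (forall i, e i *m e i = e i) ->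
  (forall i, e i = 0) \/ (forall i, e i = 1%:M).
Proof.
move=> [_ indM] he ide.
pose e' i := 1%:M - e i.
have he' : is_hom M M e' by move=> a; rewrite mulmxBr mulmxBl mulmx1 mul1mx he.
have ee' i : e i *m e' i = 0 by rewrite mulmxBr mulmx1 ide subrr.
have e'e i : e' i *m e i = 0 by rewrite mulmxBl mul1mx ide subrr.
have ide' i : e' i *m e' i = e' i by rewrite mulmxBl mul1mx ee' subr0.
have [r [C [R [CR RC]]]] := idem_split ide.
have [r' [C' [R' [CR' RC']]]] := idem_split ide'.
pose N : rep G F r := fun a =>
  R (src G a) *m M a *m C (tgt G a).
pose N' : rep G F r' := fun a =>
  R' (src G a) *m M a *m C' (tgt G a).
pose f i := row_mx (C i) (C' i); pose g i := col_mx (R i) (R' i).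
have RC0 i : R i *m C' i = 0 by apply: split_orth => //; rewrite CR CR'.
have R'C0 i : R' i *m C i = 0 by apply: split_orth => //; rewrite CR CR'.
case: (indM _ _ N N') => [|r0|r0].
- exists f, g; split=> [a|a|i|i].
  + rewrite /f /dsum mul_row_block !mulmx0 addr0 add0r mul_mx_row /N /N' !mulmxA.
    by rewrite CR CR' -he -he' -!mulmxA -CR -CR' -!mulmxA RC RC' !mulmx1.
  + rewrite /g /dsum mul_block_col !mul0mx addr0 add0r mul_col_mx /N /N'.
    by rewrite -!mulmxA CR CR' he he' !mulmxA -CR -CR' !mulmxA RC RC' !mul1mx.
  + by rewrite mul_row_col CR CR' addrC subrK.
  + by rewrite mul_col_row RC RC' RC0 R'C0 -scalar_mx_block.
- by left=> i; rewrite -CR (eq_mx_dim0 (R i) 0 (r0 i)) mulmx0.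
right=> i; apply/esym/eqP; rewrite -subr_eq0 -[_ - _]/(e' i).
by rewrite -CR' (eq_mx_dim0 (R' i) 0 (r0 i)) mulmx0.
Qed.

(** The projection to the first summand of a direct sum is an idempotent
endomorphism. *)
Lemma indecomposable_of_idem : (exists i, d i <> 0%N) ->
  (forall e, is_hom M M e -> (forall i, e i *m e i = e i) ->
     (forall i, e i = 0) \/ (forall i, e i = 1%:M)) ->
  indecomposable M.
Proof.
move=> dnz idM; split=> // d1 d2 M1 M2 [f [g [hf hg fg gf]]].
pose p i : 'M[F]_(d1 i + d2 i)%N := block_mx 1%:M 0 0 0.
pose e i := f i *m p i *m g i.
have defp i : p i = g i *m e i *m f i.
  by rewrite /e !mulmxA gf mul1mx -mulmxA gf mulmx1.
case: (idM e) => [a|i|e0|e1].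
- have Dp : dsum M1 M2 a *m p (tgt G a) = p (src G a) *m dsum M1 M2 a.
    by rewrite !mulmx_block !(mulmx0, mul0mx, mulmx1, mul1mx, addr0).
  by rewrite /e !mulmxA hf -(mulmxA (f _)) Dp -!mulmxA hg.
- have pp : p i *m p i = p i.
    by rewrite mulmx_block !(mulmx0, mul0mx, mulmx1, addr0).
  by rewrite {3}/e -pp /e !mulmxA -(mulmxA _ (g i)) gf mulmx1.
- left=> i; have := defp i; rewrite e0 mulmx0 mul0mx => /(congr1 ulsubmx).
  have -> : ulsubmx (0 : 'M[F]_(d1 i + d2 i)) = 0 by apply/matrixP=> x y; rewrite !mxE.
  by rewrite block_mxKul => /(congr1 mxrank); rewrite mxrank1 mxrank0.
right=> i; have := defp i; rewrite e1 mulmx1 gf => /(congr1 drsubmx).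
rewrite scalar_mx_block !block_mxKdr => /(congr1 mxrank).
by rewrite mxrank1 mxrank0.
Qed.
End Endomorphisms.

(** * Absolute indecomposability through traces *)

Definition supported (V : eqType) (d : V -> nat) (s : seq V) :=
  forall i, i \notin s -> d i = 0%N.

(** Dimensions up to [N] can be read off in [F]: an idempotent of size at most [N]
with trace zero is zero, and one with the trace of the identity is the identity. *)
Definition small_char (F : fieldType) (N : nat) :=
  forall m, (0 < m <= N)%N -> m%:R != 0 :> F.

(** Sums range over a list [s] containing the support of [d], because the covering
quiver has infinitely many vertices. *)
Definition total_dim (V : eqType) (d : V -> nat) (s : seq V) : nat :=
  (\sum_(i <- s) d i)%N.

Definition total_trace (V : eqType) (F : fieldType) (d : V -> nat) (s : seq V)
    (f : forall i, 'M[F]_(d i)) : F := \sum_(i <- s) \tr (f i).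

(** If every endomorphism is the sum of a scalar and a nilpotent one, that scalar
is the trace divided by the total dimension, and taking it is a ring morphism;
[tracial] says that it is multiplicative, cleared of denominators. *)
Definition tracial (V : eqType) (A : Type) (G : quiver V A) (F : fieldType)
    (d : V -> nat) (s : seq V) (M : rep G F d) : Prop :=
  (0 < total_dim d s)%N /\
  forall f g, is_hom M M f -> is_hom M M g ->
    (total_dim d s)%:R * total_trace s (fun i => f i *m g i) =
    total_trace s f * total_trace s g.

Section TracialFacts.
Variables (V : eqType) (A : Type) (G : quiver V A) (d : V -> nat) (s : seq V).
Hypothesis sup_d : supported d s.

Lemma total_dim_gt0P : (0 < total_dim d s)%N <-> exists i, d i <> 0%N.
Proof.
rewrite lt0n /total_dim sum_nat_seq_neq0; split.
  by case/hasP=> i _ /andP[_ /eqP di]; exists i.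
case=> i di; apply/hasP; exists i; last exact/eqP.
by apply: contra_notT di => /sup_d.
Qed.

Section AnyField.
Variable F : fieldType.
Implicit Types M : rep G F d.

Lemma total_trace_scalar c :
  total_trace s (fun i => c%:M : 'M[F]_(d i)) = c *+ total_dim d s.
Proof.
by rewrite /total_trace /total_dim (eq_bigr _ (fun i _ => mxtrace_scalar _ _)) sumrMnr.
Qed.

Lemma total_trace_add (f g : forall i, 'M[F]_(d i)) :
  total_trace s (fun i => f i + g i) = total_trace s f + total_trace s g.
Proof. by rewrite -big_split; apply: eq_bigr => i _; rewrite linearD. Qed.

Lemma total_trace_opp (f : forall i, 'M[F]_(d i)) :
  total_trace s (fun i => - f i) = - total_trace s f.
Proof. by rewrite -sumrN; apply: eq_bigr => i _; rewrite linearN. Qed.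

Lemma total_trace_nilp (f : forall i, 'M[F]_(d i)) m :
  (forall i, f i ^+ m = 0) -> total_trace s f = 0.
Proof. by move=> nf; apply: big1 => i _; apply: mxtrace_nilp (nf i). Qed.

(** The trace of an idempotent [e] is its total rank, and [e * e = e] forces this
rank to be a root of [x * (total_dim - x)] in [F]. *)
Lemma tracial_idem M e : small_char F (total_dim d s) -> tracial s M ->
  is_hom M M e -> (forall i, e i *m e i = e i) ->
  (forall i, e i = 0) \/ (forall i, e i = 1%:M).
Proof.
move=> smallF [_ trM] he ide.
pose r := (\sum_(i <- s) \rank (e i))%N; pose N := total_dim d s.
have le_rd i : (\rank (e i) <= d i)%N by apply: rank_leq_row.
have le_rN : (r <= N)%N by apply: leq_sum.
have defr : total_trace s e = r%:R.
  by rewrite /total_trace natr_sum; apply: eq_bigr => i _; apply: mxtrace_idem.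
have tree : total_trace s (fun i => e i *m e i) = total_trace s e.
  by apply: eq_bigr => i _; rewrite ide.
have := trM e e he he; rewrite tree defr -!natrM => /eqP.
rewrite -subr_eq0 -natrB ?leq_mul2r ?le_rN ?orbT // -mulnBl natrM mulf_eq0.
have nat0 k : (k <= N)%N -> k%:R == 0 :> F -> k = 0%N.
  move=> kN k0; case: k kN k0 => // k kN.
  by rewrite (negbTE (smallF _ _)).
case/orP=> /nat0 z.
  right=> i; have [|/sup_d di] := boolP (i \in s); last exact: eq_mx_dim0.
  move=> si; have : (\sum_(i <- s) (d i - \rank (e i)))%N = 0%N.
    by rewrite sumnB; [exact: z (leq_subr _ _) | move=> j _; exact: le_rd].
  move/eqP; rewrite sum_nat_seq_eq0 => /allP/(_ i si); rewrite /= subn_eq0 => ri.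
  have ui : e i \in unitmx by rewrite -row_free_unit /row_free eqn_leq le_rd.
  by rewrite -[LHS]mul1mx -(mulVmx ui) -mulmxA ide mulVmx.
left=> i; have [|/sup_d di] := boolP (i \in s); last exact: eq_mx_dim0.
move=> si; move/eqP: (z le_rN).
rewrite sum_nat_seq_eq0 => /allP/(_ i si) /=.
by rewrite mxrank_eq0 => /eqP.
Qed.

Lemma tracial_indecomposable M : small_char F (total_dim d s) -> tracial s M ->
  indecomposable M.
Proof.
move=> smallF trM; apply: indecomposable_of_idem.
  by apply/total_dim_gt0P; case: trM.
by move=> e; apply: tracial_idem.
Qed.

(** Let [x] and [y] be the nilpotent parts of [f] and [g].  The only term of
[f * g] whose trace is not obvious is [x * y], itself a scalar plus a nilpotent;
the scalar vanishes, as otherwise [x * y], hence [x], would be invertible. *)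
Lemma tracial_of_nilp M : small_char F (total_dim d s) -> (0 < total_dim d s)%N ->
  (forall f, is_hom M M f -> exists m,
     forall i, (f i - (total_trace s f / (total_dim d s)%:R)%:M) ^+ m = 0) ->
  tracial s M.
Proof.
move=> smallF N0 nilM; split=> // f g hf hg.
have [i0 di0] := total_dim_gt0P.1 N0.
set N := (total_dim d s)%:R.
have Nnz : N != 0 :> F by rewrite smallF // N0 leqnn.
set lf := total_trace s f / N; set lg := total_trace s g / N.
pose x i := f i - lf%:M; pose y i := g i - lg%:M.
have hx : is_hom M M x by apply: is_hom_add => //; apply/is_hom_opp/is_hom_scalar.
have hy : is_hom M M y by apply: is_hom_add => //; apply/is_hom_opp/is_hom_scalar.
have hxy : is_hom M M (fun i => x i *m y i).
  by move=> a; rewrite mulmxA hx -mulmxA hy mulmxA.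
have [mx nilx] := nilM f hf; have [my nily] := nilM g hg.
have [m nilxy] := nilM _ hxy.
have txy : total_trace s (fun i => x i *m y i) = 0.
  apply/eqP/negPn/negP => nz.
  have cnz : total_trace s (fun i => x i *m y i) / N != 0 by rewrite mulf_neq0 ?invr_eq0.
  have := unitmx_add_nilp cnz (nilxy i0); rewrite unitmx_mul => /andP[ux _].
  have := unitmx_exp mx ux; rewrite nilx -row_free_unit /row_free mxrank0.
  by rewrite eq_sym; apply/negP/eqP.
have tx : total_trace s x = 0 by apply: total_trace_nilp nilx.
have ty : total_trace s y = 0 by apply: total_trace_nilp nily.
have -> : total_trace s (fun i => f i *m g i) = lf * lg * N.
  transitivity (total_trace s (fun i => x i *m y i) + lf * total_trace s y
     + lg * total_trace s x
     + lf * lg * N); last by rewrite txy tx ty !mulr0 !add0r.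
  rewrite /N mulr_natr -total_trace_scalar /total_trace !mulr_sumr -!big_split /=.
  apply: eq_bigr => i _; rewrite -!mxtraceZ -!mxtraceD; congr (\tr _).
  have ef : f i = x i + lf%:M by rewrite subrK.
  have eg : g i = y i + lg%:M by rewrite subrK.
  rewrite ef eg; clearbody x y; rewrite mulmxDl !mulmxDr mul_mx_scalar !mul_scalar_mx.
  by rewrite scale_scalar_mx addrA; congr (_ + _); rewrite addrAC.
rewrite -[total_trace s f](divfK Nnz) -[total_trace s g](divfK Nnz) -/lf -/lg.
by rewrite mulrCA mulrACA.
Qed.
End AnyField.

(** Over an extension containing an eigenvalue [z] of [f] at one vertex, [f - z]
is not invertible, so by indecomposability over that extension it is nilpotent.
Taking traces, [z] is the normalised trace of [f], which lies in [F]. *)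
Lemma abs_indecomposable_tracial (F : finFieldType) (M : rep G F d) :
  small_char F (total_dim d s) -> abs_indecomposable M -> tracial s M.
Proof.
move=> smallF aiM.
have [i0 di0] : exists i, d i <> 0%N.
  have [L _] := FinSplittingFieldFor (oner_neq0 {poly F}).
  by case: (aiM L).
have N0 : (0 < total_dim d s)%N by apply/total_dim_gt0P; exists i0.
have Nnz : (total_dim d s)%:R != 0 :> F by rewrite smallF // N0 leqnn.
apply: tracial_of_nilp => // f hf.
have [L [rs split_rs _]] : {L : splittingFieldType F |
    splittingFieldFor (1 : {vspace L})
    (map_poly (in_alg L) (char_poly (f i0))) fullv}.
  by apply: FinSplittingFieldFor; rewrite monic_neq0 ?char_poly_monic.
pose fL i := map_mx (in_alg L) (f i).
have [z rz] : exists z, root (char_poly (fL i0)) z.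
  rewrite -map_char_poly; case: rs split_rs => [|z rs] split_rs.
    move/eqp_size: split_rs; rewrite big_nil size_poly1 size_map_poly size_char_poly.
    by case=> /di0.
  by exists z; rewrite (eqp_root split_rs) big_cons rootM root_XsubC eqxx.
pose K : finFieldType := finvect_type L.
pose g i : 'M[K]_(d i) := fL i - z%:M.
have hfL : is_hom (base_change L M) (base_change L M) fL.
  by move=> a; rewrite -!map_mxM hf.
have hg : @is_hom _ _ G K d d (base_change L M) (base_change L M) g.
  apply: (@is_hom_add _ _ G K d (base_change L M) _ (fun i => - z%:M)) => //.
  apply: is_hom_opp; exact: is_hom_scalar.
have [m m0 idg] := family_exp_idem s g.
have idg' i : g i ^+ m *m g i ^+ m = g i ^+ m.
  by have [/idg//|/sup_d di] := boolP (i \in s); apply: eq_mx_dim0.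
have [nilg|unig] := @indecomposable_idem _ _ G K d (base_change L M) _
   (aiM L) (is_hom_exp m hg) idg'; last first.
  have ug : g i0 \in unitmx.
    have := unig i0; rewrite -(prednK m0) exprS.
    by case/mulmx1_unit.
  move: rz; rewrite -eigenvalue_root_char => /eigenvalueP[v vz /eqP[]].
  have vg : v *m (g i0 : 'M[L]_(d i0)) = 0.
    by rewrite mulmxBr vz mul_mx_scalar subrr.
  have : v *m (g i0 *m invmx (g i0 : 'M[L]_(d i0))) = 0 by rewrite mulmxA vg mul0mx.
  by rewrite (@mulmxV L) // mulmx1.
pose N := total_dim d s.
have tz : in_alg L (total_trace s f) = z *+ N.
  have : total_trace s (fun i => fL i - z%:M) = 0 := @total_trace_nilp K g m nilg.
  rewrite total_trace_add total_trace_opp total_trace_scalar => /subr0_eq <-.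
  by rewrite /total_trace raddf_sum; apply: eq_bigr => i _; rewrite trace_map_mx.
have defz : in_alg L (total_trace s f / N%:R) = z.
  rewrite fmorph_div rmorph_nat -[LHS]/(in_alg L (total_trace s f) / N%:R) tz.
  by rewrite -[z *+ N]mulr_natr mulfK // -(rmorph_nat (in_alg L)) fmorph_eq0.
exists m => i; apply: (map_mx_inj (f := in_alg L)).
rewrite map_mx0 -/N; transitivity (g i ^+ m); last exact: nilg.
by rewrite map_mx_exp map_mxB map_scalar_mx /g -defz.
Qed.
End TracialFacts.

Section BaseChange.
Variables (V : eqType) (A : Type) (G : quiver V A) (d : V -> nat) (s : seq V).
Hypothesis sup_d : supported d s.
Variables (F : fieldType) (K : fieldExtType F) (M : rep G F d).

Lemma total_trace_lincomb (E : fieldType) I (r : seq I) (c : I -> E)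
    (f : I -> forall i, 'M[E]_(d i)) :
  total_trace s (fun i => \sum_(j <- r) c j *: f j i) =
  \sum_(j <- r) c j * total_trace s (f j).
Proof.
rewrite /total_trace (eq_bigr (fun i => \sum_(j <- r) c j * \tr (f j i))) => [|i _].
  by rewrite exchange_big; apply: eq_bigr => j _; rewrite mulr_sumr.
by rewrite raddf_sum; apply: eq_bigr => j _; rewrite /= mxtraceZ.
Qed.

(** The equations defining endomorphisms have coefficients in [F], so the
coordinates of a solution over [K] are solutions over [F]. *)
Lemma base_change_hom (f : forall i, 'M[K]_(d i)) :
  is_hom (base_change K M) (base_change K M) f ->
  exists h : 'I_(\dim {:K}) -> forall i, 'M[F]_(d i),
    (forall j, is_hom M M (h j)) /\
    forall i, f i = \sum_(j < \dim {:K}) (vbasis {:K})`_j *: map_mx (in_alg K) (h j i).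
Proof.
move=> hf; pose h j i : 'M[F]_(d i) := map_mx (coord (vbasis {:K}) j) (f i).
exists h; split=> [j a|i]; last first.
  apply/matrixP => x y; rewrite summxE [LHS](coord_vbasis (memvf _)).
  by apply: eq_bigr => j _; rewrite !mxE mulrC mulr_algl.
have cA c u : coord (vbasis {:K}) j (in_alg K c * u) = c * coord (vbasis {:K}) j u.
  by rewrite -[in_alg K c]/(c%:A) mulr_algl linearZ.
apply/matrixP => x y; have /matrixP/(_ x y) := hf a.
rewrite !mxE => /(congr1 (coord (vbasis {:K}) j)); rewrite !raddf_sum => eq_xy.
transitivity (\sum_k coord (vbasis {:K}) j (base_change K M a x k * f (tgt G a) k y)).
  by apply: eq_bigr => k _; rewrite !mxE; exact/esym/cA.
rewrite eq_xy; apply: eq_bigr => k _.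
by rewrite !mxE [f _ x k * _]mulrC [RHS]mulrC; exact: cA.
Qed.

(** The multiplicativity of the normalised trace is a bilinear condition on a
space of endomorphisms that is spanned by those defined over [F]. *)
Lemma tracial_base_change : tracial s M -> tracial s (base_change K M).
Proof.
move=> [N0 trM]; split=> // f g hf hg.
have [hfs [hhf deff]] := base_change_hom hf.
have [hgs [hhg defg]] := base_change_hom hg.
set b := vbasis {:K} in deff defg *.
pose al (h : forall i, 'M[F]_(d i)) i := map_mx (in_alg K) (h i).
have tal h : total_trace s (al h) = in_alg K (total_trace s h).
  by rewrite /total_trace raddf_sum; apply: eq_bigr => i _; rewrite trace_map_mx.
have -> : total_trace s f = \sum_(j < \dim {:K}) b`_j * total_trace s (al (hfs j)).
  by rewrite -total_trace_lincomb; apply: eq_bigr => i _; rewrite deff.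
have -> : total_trace s g = \sum_(j < \dim {:K}) b`_j * total_trace s (al (hgs j)).
  by rewrite -total_trace_lincomb; apply: eq_bigr => i _; rewrite defg.
have -> : total_trace s (fun i => f i *m g i) =
    \sum_(j < \dim {:K}) \sum_(k < \dim {:K})
      b`_j * b`_k * total_trace s (al (fun i => hfs j i *m hgs k i)).
  rewrite pair_bigA -total_trace_lincomb; apply: eq_bigr => i _; congr (\tr _).
  rewrite deff defg mulmx_suml -(pair_bigA _ (fun j k : 'I_(\dim {:K}) =>
    (b`_j * b`_k) *: al (fun i => hfs j i *m hgs k i) i)) /=.
  apply: eq_bigr => j _; rewrite mulmx_sumr; apply: eq_bigr => k _.
  by rewrite -scalemxAl -scalemxAr scalerA /al map_mxM.
rewrite mulr_sumr mulr_suml; apply: eq_bigr => j _.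
rewrite [LHS]mulr_sumr [RHS]mulr_sumr; apply: eq_bigr => k _.
rewrite !tal [LHS]mulrCA [RHS]mulrACA; congr (_ * _).
by have := congr1 (in_alg K) (trM _ _ (hhf j) (hhg k)); rewrite !rmorphM rmorph_nat.
Qed.

End BaseChange.

Section TracialMain.
Variables (V : eqType) (A : Type) (G : quiver V A) (d : V -> nat) (s : seq V).
Hypothesis sup_d : supported d s.

Lemma small_char_ext (F : fieldType) (K : fieldExtType F) N :
  small_char F N -> small_char K N.
Proof.
move=> smallF m /smallF; apply: contraNneq => m0.
by rewrite -(fmorph_eq0 (in_alg K)) rmorph_nat m0.
Qed.

Lemma tracial_abs_indecomposable (F : fieldType) (M : rep G F d) :
  small_char F (total_dim d s) -> tracial s M -> abs_indecomposable M.
Proof.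
move=> smallF trM K.
apply: (@tracial_indecomposable _ _ _ _ _ sup_d K).
  exact: small_char_ext.
exact: tracial_base_change.
Qed.

Variables (F : finFieldType) (M : rep G F d).
Hypotheses (smallF : small_char F (total_dim d s)) (trM : tracial s M).

Lemma total_dim_nz : (total_dim d s)%:R != 0 :> F.
Proof. by case: trM => N0 _; rewrite smallF // N0 leqnn. Qed.

Lemma total_trace_exp_eq0 h m : is_hom M M h ->
  (total_trace s (fun i => h i ^+ m.+1) == 0) = (total_trace s h == 0).
Proof.
move=> hh; elim: m => [|m IH].
  by rewrite /total_trace; under eq_bigr do rewrite expr1.
have := trM.2 _ _ hh (is_hom_exp m.+1 hh).
have -> : total_trace s (fun i => h i *m h i ^+ m.+1) =
          total_trace s (fun i => h i ^+ m.+2).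
  by apply: eq_bigr => i _; rewrite (exprS _ m.+1).
move/(congr1 (fun c => c == 0)); rewrite !mulf_eq0 IH orbb (negbTE total_dim_nz).
by [].
Qed.

(** Some power of [h] is an idempotent endomorphism, so it is zero or the identity,
and by multiplicativity its trace vanishes exactly when that of [h] does. *)
Lemma tracial_dichotomy h : is_hom M M h ->
  (total_trace s h != 0 /\ forall i, h i \in unitmx) \/
  (total_trace s h = 0 /\ exists m, forall i, h i ^+ m = 0).
Proof.
move=> hh; have [[|m] // _ idh] := family_exp_idem s h.
have idh' i : h i ^+ m.+1 *m h i ^+ m.+1 = h i ^+ m.+1.
  by have [/idh//|/sup_d di] := boolP (i \in s); apply: eq_mx_dim0.
have [nilh|unih] := tracial_idem sup_d smallF trM (is_hom_exp m.+1 hh) idh'.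
  right; split; last by exists m.+1.
  by apply: total_trace_nilp nilh.
left; split; last first.
  by move=> i; have := unih i; rewrite exprS => /mulmx1_unit[].
rewrite -(total_trace_exp_eq0 m hh).
have -> : total_trace s (fun i => h i ^+ m.+1) = (total_dim d s)%:R.
  rewrite -[_%:R](total_trace_scalar d s 1); apply: eq_bigr => i _; by rewrite unih.
exact: total_dim_nz.
Qed.

End TracialMain.

(** * Gradings by the lattice and their homogeneous pieces *)

(** The index of the only possibly nonzero term need not occur in the list, which
spares a case distinction on the support of gradings. *)
Lemma big_seq_only (R : nmodType) (I : eqType) (r : seq I) (i0 : I) (F : I -> R) :
  uniq r -> (forall i, i != i0 -> F i = 0) -> (i0 \notin r -> F i0 = 0) ->
  \sum_(i <- r) F i = F i0.
Proof.
move=> ur F0 Fn; have [ir|nir] := boolP (i0 \in r).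
  by rewrite (bigD1_seq i0) //= big1 ?addr0.
rewrite Fn // big_seq big1 // => i ir; apply: F0.
by apply: contraNneq nir => <-.
Qed.

Lemma big_shift (R : nmodType) (V : zmodType) (X D : seq V) (c : V) (T : V -> R) :
  uniq X -> uniq D -> (forall x, x \in X -> x - c \in D) ->
  (forall x, x \notin X -> T x = 0) ->
  \sum_(x <- X) T x = \sum_(y <- D) T (c + y).
Proof.
move=> uX uD XD T0; rewrite -(big_map (+%R c) xpredT T).
rewrite -[RHS](@big_rmcond _ _ _ _ _ (fun x => x \in X)) //= -[RHS]big_filter.
apply: perm_big.
have uD' : uniq [seq c + y | y <- D] by rewrite map_inj_uniq // => ? ? /addrI.
apply: uniq_perm => //; first exact: filter_uniq.
move=> x; rewrite mem_filter; case xX: (x \in X) => //=; apply/esym/mapP.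
by exists (x - c); rewrite ?XD // addrC subrK.
Qed.

Section Gradings.
Variables (V A : finType) (G : quiver V A) (alpha : V -> nat) (F : fieldType).
Local Notation lattice := {ffun A -> int}.
Local Notation cdim beta := (fun x : V * lattice => beta x.1 x.2).
Local Notation cover := (covering_quiver G).
Local Notation vs := (index_enum V).
Implicit Types (beta : V -> lattice -> nat) (X : seq lattice) (M : rep G F alpha).

(** As matrices act on row vectors, [J i chi] is the inclusion of the part of
degree [chi] of [M_i] and [P i chi] the projection onto it.  The last condition
says that [M_a] raises the degree by [unit_vec a]. *)
Definition grading M beta (J : forall i chi, 'M[F]_(beta i chi, alpha i))
    (P : forall i chi, 'M[F]_(alpha i, beta i chi)) X : Prop :=
  [/\ uniq X,
      forall i chi, J i chi *m P i chi = 1%:M,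
      forall i chi chi', chi != chi' -> J i chi *m P i chi' = 0,
      forall i, \sum_(chi <- X) P i chi *m J i chi = 1%:M
    & forall a chi chi', chi' != chi + unit_vec a ->
        J (src G a) chi *m M a *m P (tgt G a) chi' = 0].

Definition graded_block M beta (J : forall i chi, 'M[F]_(beta i chi, alpha i))
    (P : forall i chi, 'M[F]_(alpha i, beta i chi)) (a : A) (chi : lattice) :
    'M[F]_(beta (src G a) chi, beta (tgt G a) (chi + unit_vec a)) :=
  J (src G a) chi *m M a *m P (tgt G a) (chi + unit_vec a).

(** The representation of the covering quiver that corresponds to a grading. *)
Definition piece M beta (J : forall i chi, 'M[F]_(beta i chi, alpha i))
    (P : forall i chi, 'M[F]_(alpha i, beta i chi)) : rep cover F (cdim beta) :=
  fun a => graded_block M J P a.1 a.2.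

Definition cov_seq X : seq (V * lattice) := [seq (i, chi) | i <- vs, chi <- X].

Section OneGrading.
Variables (M : rep G F alpha) (beta : V -> lattice -> nat).
Variables (J : forall i chi, 'M[F]_(beta i chi, alpha i)).
Variables (P : forall i chi, 'M[F]_(alpha i, beta i chi)) (X : seq lattice).
Hypothesis gr : grading M J P X.

Lemma grading_dim0 i chi : chi \notin X -> beta i chi = 0%N.
Proof.
case: gr => _ JP1 JP0 PJ1 _ nX.
suff: \rank (1%:M : 'M[F]_(beta i chi)) = 0%N by rewrite mxrank1.
rewrite -JP1 -[J i chi]mulmx1 -PJ1 mulmx_sumr big_seq big1 => [|c cX].
  by rewrite mul0mx mxrank0.
by rewrite mulmxA JP0 ?mul0mx //; apply: contraNneq nX => ->.
Qed.

Lemma grading_supported : supported (cdim beta) (cov_seq X).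
Proof.
case=> i chi nX; apply: grading_dim0; apply: contra nX => cX.
by apply/allpairsP; exists (i, chi); rewrite mem_index_enum.
Qed.

Lemma grading_sum_dim i : (\sum_(chi <- X) beta i chi)%N = alpha i.
Proof.
case: gr => uX JP1 JP0 PJ1 _; rewrite -[RHS](mxrank1 F) -PJ1.
have id chi : P i chi *m J i chi *m (P i chi *m J i chi) = P i chi *m J i chi.
  by rewrite -mulmxA (mulmxA (J i chi)) JP1 mul1mx.
rewrite mxrank_orth_sum // => [|c c' _ _ nc].
  apply: eq_bigr => chi _; apply/eqP; rewrite eqn_leq andbC; apply/andP; split.
    by apply: leq_trans (mxrankM_maxl _ _) (rank_leq_col _).
  have JPJP : J i chi *m (P i chi *m J i chi) *m P i chi = 1%:M.
    by rewrite mulmxA JP1 mul1mx JP1.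
  rewrite -[leqLHS](mxrank1 F) -JPJP.
  by apply: leq_trans (mxrankM_maxl _ _) (mxrankM_maxr _ _).
by rewrite -mulmxA (mulmxA (J i c)) JP0 // mul0mx mulmx0.
Qed.

Lemma cov_total_dim : total_dim (cdim beta) (cov_seq X) = total_dim alpha vs.
Proof.
by rewrite /total_dim big_allpairs; apply: eq_bigr => i _; apply: grading_sum_dim.
Qed.

Lemma J_hom a chi :
  J (src G a) chi *m M a = graded_block M J P a chi *m J (tgt G a) (chi + unit_vec a).
Proof.
case: gr => uX JP1 JP0 PJ1 hom.
rewrite -[LHS]mulmx1 -PJ1 mulmx_sumr (big_seq_only (i0 := chi + unit_vec a)) //.
- by rewrite mulmxA.
- by move=> c nc; rewrite mulmxA hom // mul0mx.
by move=> /grading_dim0 d0; rewrite (eq_mx_dim0 (J _ _) 0 (d0 _)) !mulmx0.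
Qed.

Lemma P_hom a chi :
  M a *m P (tgt G a) (chi + unit_vec a) = P (src G a) chi *m graded_block M J P a chi.
Proof.
case: gr => uX JP1 JP0 PJ1 hom.
rewrite -[LHS]mul1mx -PJ1 mulmx_suml (big_seq_only (i0 := chi)) //.
- by rewrite /graded_block -!mulmxA.
- move=> c nc; rewrite -mulmxA [J _ _ *m _]mulmxA hom ?mulmx0 //.
  by apply: contra nc => /eqP/addIr ->.
by move=> /grading_dim0 d0; rewrite -mulmxA (eq_mx_dim0 (J _ _) 0 (d0 _)) mul0mx mulmx0.
Qed.

Lemma eq_by_J m i (B C : 'M[F]_(alpha i, m)) :
  (forall chi, J i chi *m B = J i chi *m C) -> B = C.
Proof.
case: gr => _ _ _ PJ1 _ JBC; rewrite -[B]mul1mx -[C]mul1mx -PJ1 !mulmx_suml.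
by apply: eq_bigr => chi _; rewrite -!mulmxA JBC.
Qed.

(** The trace only sees the degree zero part of an endomorphism. *)
Lemma total_trace_piece (u : forall i, 'M[F]_(alpha i)) :
  total_trace vs u = total_trace (cov_seq X) (fun x => J x.1 x.2 *m u x.1 *m P x.1 x.2).
Proof.
case: gr => _ _ _ PJ1 _; rewrite /total_trace big_allpairs; apply: eq_bigr => i _.
rewrite -[LHS](congr1 mxtrace (mul1mx (u i))) -PJ1 mulmx_suml raddf_sum.
by apply: eq_bigr => chi _ /=; rewrite -mulmxA mxtrace_mulC.
Qed.
End OneGrading.

Section TwoGradings.
Variables (M M' : rep G F alpha) (beta beta' : V -> lattice -> nat).
Variables (J : forall i chi, 'M[F]_(beta i chi, alpha i)).
Variables (P : forall i chi, 'M[F]_(alpha i, beta i chi)) (X : seq lattice).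
Variables (J' : forall i chi, 'M[F]_(beta' i chi, alpha i)).
Variables (P' : forall i chi, 'M[F]_(alpha i, beta' i chi)) (X' : seq lattice).
Hypotheses (gr : grading M J P X) (gr' : grading M' J' P' X').

(** The degree zero part of a homomorphism of graded representations.  Other
degrees are obtained by shifting one of the two gradings. *)
Lemma hom_piece (u : forall i, 'M[F]_(alpha i)) : is_hom M M' u ->
  is_hom (piece M J P) (piece M' J' P')
    (fun x => J x.1 x.2 *m u x.1 *m P' x.1 x.2).
Proof.
move=> hu [a chi]; have eJ := J_hom gr a chi; have eP := P_hom gr' a chi.
rewrite /piece /=.
move: (graded_block M J P a chi) (graded_block M' J' P' a chi) eJ eP => N N' eJ eP.
by rewrite !mulmxA -eJ -[_ *m M a *m _]mulmxA hu -!mulmxA eP.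
Qed.

Definition push (h : forall x, 'M[F]_(beta x.1 x.2, beta' x.1 x.2)) i :
    'M[F]_(alpha i) := \sum_(chi <- X) P i chi *m h (i, chi) *m J' i chi.

Lemma J_push h i chi : J i chi *m push h i = h (i, chi) *m J' i chi.
Proof.
case: (gr) => uX JP1 JP0 _ _.
rewrite mulmx_sumr (big_seq_only (i0 := chi)) // => [|c nc|nX].
- by rewrite !mulmxA JP1 mul1mx.
- by rewrite !mulmxA JP0 ?mul0mx // eq_sym.
by rewrite (eq_mx_dim0 (J _ _) 0 (grading_dim0 gr _ nX)) mul0mx.
Qed.

Lemma push_hom h : is_hom (piece M J P) (piece M' J' P') h -> is_hom M M' (push h).
Proof.
move=> hh a; apply: (eq_by_J gr) => chi.
have eJ := J_hom gr a chi; have eJ' := J_hom gr' a chi.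
have := hh (a, chi); rewrite /piece /=.
move: (graded_block M J P a chi) (graded_block M' J' P' a chi) eJ eJ' => N N' eJ eJ' eh.
by rewrite !mulmxA eJ -mulmxA !J_push mulmxA eh -!mulmxA eJ'.
Qed.
End TwoGradings.

Section Trace.
Variables (M : rep G F alpha) (beta : V -> lattice -> nat).
Variables (J : forall i chi, 'M[F]_(beta i chi, alpha i)).
Variables (P : forall i chi, 'M[F]_(alpha i, beta i chi)) (X : seq lattice).
Hypothesis gr : grading M J P X.
Let N := piece M J P.
Let s' := cov_seq X.

Lemma total_trace_push h : total_trace vs (push P X J h) = total_trace s' h.
Proof.
rewrite (total_trace_piece gr); apply: eq_bigr => [[i chi]] _ /=.
by case: (gr) => _ JP1 _ _ _; rewrite (J_push J gr) -mulmxA JP1 mulmx1.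
Qed.

(** Endomorphisms of the piece are the degree zero endomorphisms of [M], with the
same trace. *)
Lemma tracial_piece : tracial vs M -> tracial s' N.
Proof.
case=> N0 trM; split; first by rewrite (cov_total_dim gr).
move=> f g hf hg; rewrite (cov_total_dim gr) -!total_trace_push.
rewrite -trM; [|exact: (push_hom gr gr hf)|exact: (push_hom gr gr hg)].
congr (_ * _); rewrite total_trace_push (total_trace_piece gr).
apply: eq_bigr => [[i chi]] _ /=.
case: (gr) => _ JP1 _ _ _.
by rewrite mulmxA (J_push J gr) -(mulmxA (f (i, chi))) (J_push J gr) -!mulmxA JP1 mulmx1.
Qed.
End Trace.

Section Shift.
Variables (M : rep G F alpha) (beta : V -> lattice -> nat).
Variables (J : forall i chi, 'M[F]_(beta i chi, alpha i)).
Variables (P : forall i chi, 'M[F]_(alpha i, beta i chi)) (X : seq lattice).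

Lemma grading_shift (xi : lattice) : grading M J P X ->
  grading M (beta := fun i chi => beta i (chi + xi)) (fun i chi => J i (chi + xi))
    (fun i chi => P i (chi + xi)) [seq chi - xi | chi <- X].
Proof.
case=> uX JP1 JP0 PJ1 hom; split.
- by rewrite map_inj_uniq // => ? ? /addIr.
- by move=> i chi; apply: JP1.
- by move=> i c c' nc; apply: JP0; apply: contra nc => /eqP/addIr->.
- by move=> i; rewrite big_map -[RHS]PJ1; apply: eq_bigr => c _; rewrite subrK.
move=> a c c' nc; apply: hom; apply: contra nc => /eqP.
by rewrite addrAC => /addIr ->.
Qed.

(** The support of [beta] is finite and, by the inequality, stable under translation
by [xi]; a nonzero [xi] would translate a degree of it out of [X]. *)
Lemma no_shift (xi : lattice) : grading M J P X -> (0 < total_dim alpha vs)%N ->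
  (forall i chi, beta i chi <= beta i (chi + xi)%R)%N -> xi = 0.
Proof.
move=> gr; rewrite -(cov_total_dim gr) => /(total_dim_gt0P (grading_supported gr)).
case=> [[i chi] /= bnz] le_b.
have inX k : chi + xi *+ k \in X.
  apply: contraT => /(grading_dim0 gr i); elim: k => [|k IH].
    by rewrite addr0.
  move=> b0; apply: IH; apply/eqP; rewrite -leqn0 -b0 mulrSr addrA; exact: le_b.
apply/ffunP => a; apply/eqP/negPn/negP; rewrite ffunE => xia.
have : (size [seq (chi + xi *+ k)%R | k <- iota 0 (size X).+1] <= size X)%N.
  apply: uniq_leq_size; last by move=> _ /mapP[k _ ->].
  rewrite map_inj_uniq ?iota_uniq // => k l /addrI /ffunP/(_ a).
  have E j : (xi *+ j) a = xi a *+ j.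
    by elim: j => [|j IHj]; rewrite ?ffunE // !mulrS ffunE IHj.
  by rewrite !E => /(mulrIn xia).
by rewrite size_map size_iota ltnn.
Qed.
End Shift.
End Gradings.

(** * Uniqueness of gradings up to translation *)

Section Comparison.
Variables (V A : finType) (G : quiver V A) (alpha : V -> nat) (F : finFieldType).
Local Notation lattice := {ffun A -> int}.
Local Notation cdim beta := (fun x : V * lattice => beta x.1 x.2).
Local Notation cover := (covering_quiver G).
Local Notation vs := (index_enum V).
Hypothesis smallF : small_char F (total_dim alpha vs).

Section TwoGradings.
Variables (M M' : rep G F alpha) (beta beta' : V -> lattice -> nat).
Variables (J : forall i chi, 'M[F]_(beta i chi, alpha i)).
Variables (P : forall i chi, 'M[F]_(alpha i, beta i chi)) (X : seq lattice).
Variables (J' : forall i chi, 'M[F]_(beta' i chi, alpha i)).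
Variables (P' : forall i chi, 'M[F]_(alpha i, beta' i chi)) (X' : seq lattice).
Hypotheses (gr : grading M J P X) (gr' : grading M' J' P' X').
Variables (u v : forall i, 'M[F]_(alpha i)).
Hypotheses (hu : is_hom M M' u) (hv : is_hom M' M v).
Let N := piece M J P.
Let s' := cov_seq V X.

(** The part of degree [xi] of [u] followed by the part of degree [- xi] of [v],
an endomorphism of the piece of [M]. *)
Definition degree_part (xi : lattice) (x : V * lattice) : 'M[F]_(beta x.1 x.2) :=
  (J x.1 x.2 *m u x.1 *m P' x.1 (x.2 + xi)) *m
  (J' x.1 (x.2 + xi) *m v x.1 *m P x.1 x.2).

Lemma degree_part_hom xi : is_hom N N (degree_part xi).
Proof.
have gs := grading_shift xi gr'.
exact: is_hom_comp (hom_piece gr gs hu) (hom_piece gs gr hv).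
Qed.

(** Insert the decomposition by [J'] and [P'] between [u] and [v], and sort the
terms by the difference [xi] of the two degrees. *)
Lemma total_trace_degree_parts : exists D : seq lattice, [/\ uniq D, 0 \in D &
  total_trace vs (fun i => u i *m v i) = \sum_(xi <- D) total_trace s' (degree_part xi)].
Proof.
have [D uD memD] : exists2 D, uniq D &
    forall d, (d \in D) = (d \in 0 :: [seq c' - c | c <- X, c' <- X']).
  exists (undup (0 :: [seq c' - c | c <- X, c' <- X'])); first exact: undup_uniq.
  exact: mem_undup.
exists D; rewrite memD inE eqxx; split=> //.
rewrite (total_trace_piece gr) /total_trace exchange_big; apply: eq_big_seq => [[i c]] /=.
case/allpairsP=> [[? c0] /= [_ cX [_ defc]]]; rewrite -{c0}defc in cX.
case: (gr') => uX' _ _ PJ1 _.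
transitivity (\sum_(c' <- X') \tr (J i c *m u i *m P' i c' *m
   (J' i c' *m v i *m P i c))).
  rewrite -raddf_sum /=; congr (\tr _).
  rewrite -[in LHS](mulmx1 (u i)) -PJ1 mulmx_sumr mulmx_suml mulmx_sumr mulmx_suml.
  apply: eq_bigr => c' _.
  by rewrite !mulmxA.
apply: (@big_shift F _ _ _ _
  (fun c' => \tr (J i c *m u i *m P' i c' *m (J' i c' *m v i *m P i c)))) => //.
- move=> c' c'X; rewrite memD inE; apply/orP; right.
  by apply/allpairsP; exists (c, c').
move=> c' /(grading_dim0 gr' i) b0.
by rewrite (eq_mx_dim0 (J' i c') 0 b0) !mul0mx mulmx0 mxtrace0.
Qed.

Hypothesis trN : tracial s' N.

Lemma small_cov : small_char F (total_dim (cdim beta) s').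
Proof. by rewrite (cov_total_dim gr). Qed.

Lemma degree_part_unit xi : total_trace s' (degree_part xi) != 0 ->
  forall x, degree_part xi x \in unitmx.
Proof.
move=> nz; have supN := grading_supported gr.
have [[_ //]|[z _]] := tracial_dichotomy supN small_cov trN (degree_part_hom xi).
by rewrite z eqxx in nz.
Qed.

(** If the trace does not vanish then, the piece being tracial, the endomorphism
is invertible; as it factors through the shifted grading, dimensions compare. *)
Lemma degree_part_dim xi : total_trace s' (degree_part xi) != 0 ->
  forall i c, (beta i c <= beta' i (c + xi)%R)%N.
Proof.
move=> /degree_part_unit unit i c; have := unit (i, c).
rewrite -row_free_unit /row_free => /eqP /= <-.
exact: leq_trans (mxrankM_maxl _ _) (rank_leq_col _).
Qed.
End TwoGradings.

Section Piece.
Variables (M : rep G F alpha) (beta : V -> lattice -> nat).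
Variables (J : forall i chi, 'M[F]_(beta i chi, alpha i)).
Variables (P : forall i chi, 'M[F]_(alpha i, beta i chi)) (X : seq lattice).
Hypothesis gr : grading M J P X.
Hypothesis trN : tracial (cov_seq V X) (piece M J P).

Lemma total_dim_gt0_of_piece : (0 < total_dim alpha vs)%N.
Proof. by case: trN => N0 _; rewrite -(cov_total_dim gr). Qed.

(** By [no_shift], the parts of nonzero degree do not contribute to the trace of
[f * g], so the multiplicativity for [M] reduces to that for degree zero. *)
Lemma tracial_of_piece : tracial vs M.
Proof.
split=> [|f g hf hg]; first exact: total_dim_gt0_of_piece.
have [D [uD D0 ->]] := total_trace_degree_parts gr gr f g.
rewrite (bigD1_seq 0) //= big1 => [|xi nz].
  rewrite addr0 (total_trace_piece gr f) (total_trace_piece gr g) -(cov_total_dim gr).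
  rewrite -trN.2; [|exact: (hom_piece gr gr hf)|exact: (hom_piece gr gr hg)].
  congr (_ * _); apply: eq_bigr => [[i c]] _.
  by rewrite /degree_part /= addr0.
apply/eqP; apply: contraNT nz => /(degree_part_dim gr gr hf hg trN) le_b.
by rewrite (no_shift gr total_dim_gt0_of_piece le_b).
Qed.
End Piece.

Section Isomorphic.
Variables (M M' : rep G F alpha) (beta beta' : V -> lattice -> nat).
Variables (J : forall i chi, 'M[F]_(beta i chi, alpha i)).
Variables (P : forall i chi, 'M[F]_(alpha i, beta i chi)) (X : seq lattice).
Variables (J' : forall i chi, 'M[F]_(beta' i chi, alpha i)).
Variables (P' : forall i chi, 'M[F]_(alpha i, beta' i chi)) (X' : seq lattice).
Hypotheses (gr : grading M J P X) (gr' : grading M' J' P' X').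
Hypothesis trN : tracial (cov_seq V X) (piece M J P).
Hypothesis isoM : isomorphic M M'.

(** The degree parts of the composite of an isomorphism and its inverse have
traces adding up to the total dimension, which is nonzero in [F]. *)
Lemma iso_degree_part : exists (u v : forall i, 'M[F]_(alpha i)) xi,
  [/\ is_hom M M' u, is_hom M' M v &
      total_trace (cov_seq V X) (degree_part J P J' P' u v xi) != 0].
Proof.
case: isoM => u [v [hu hv uv _]].
have [D [uD D0 eqt]] := total_trace_degree_parts gr gr' u v.
have /negP n0 := total_dim_nz smallF (tracial_of_piece gr trN).
have [/hasP[xi _ nz]|/hasPn z] :=
  boolP (has (fun xi => total_trace (cov_seq V X) (degree_part J P J' P' u v xi) != 0) D).
  by exists u, v, xi.
case: n0; apply/eqP; rewrite -[LHS](total_trace_scalar alpha vs 1).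
transitivity (total_trace vs (fun i => u i *m v i)).
  by apply: eq_bigr => i _; rewrite uv.
by rewrite eqt big_seq big1 // => xi /z /negPn/eqP.
Qed.

(** One inequality is [degree_part_dim]; both sides have the same sum, namely the
dimension of [M_i]. *)
Lemma iso_graded_shift :
  exists xi, forall i c, beta i c = beta' i (c + xi).
Proof.
have [u [v [xi [hu hv nz]]]] := iso_degree_part.
have le_b := degree_part_dim gr gr' hu hv trN nz.
exists xi => i c.
have gs := grading_shift xi gr'; set Xs := [seq _ | _ <- _] in gs.
have sum_u Y Z b : uniq Y -> (forall c : lattice, c \notin Y -> b c = 0%N) ->
    (\sum_(c <- undup (Y ++ Z)) b c = \sum_(c <- Y) b c)%N.
  move=> uY b0; rewrite -[LHS](@big_rmcond _ _ _ _ _ (fun x => x \in Y)) //=.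
  rewrite -[LHS]big_filter.
  apply: perm_big; apply: uniq_perm => //; first exact/filter_uniq/undup_uniq.
  by move=> x; rewrite mem_filter mem_undup mem_cat; case: (x \in Y).
have uX : uniq X by case: gr.
have uXs : uniq Xs by case: gs.
have s1 := grading_sum_dim gr i; have s2 := grading_sum_dim gs i.
rewrite -(sum_u X Xs) // in s1; last by move=> c'; apply: grading_dim0 gr i c'.
rewrite -(sum_u Xs X) // in s2; last by move=> c'; apply: grading_dim0 gs i c'.
have [|nc] := boolP (c \in undup (X ++ Xs)); last first.
  move: nc; rewrite mem_undup mem_cat negb_or => /andP[nX nXs].
  by rewrite (grading_dim0 gr) // (grading_dim0 gs i nXs).
move=> cY; apply/eqP; rewrite eqn_leq le_b /=.
have pY : perm_eq (undup (Xs ++ X)) (undup (X ++ Xs)).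
  apply: uniq_perm; rewrite ?undup_uniq // => x.
  by rewrite !mem_undup !mem_cat orbC.
rewrite (perm_big _ pY) /= -s1 !(bigD1_seq c) ?undup_uniq //= in s2.
rewrite -(leq_add2r (\sum_(c0 <- undup (X ++ Xs) | c0 != c) beta i c0)) -s2.
by rewrite leq_add2l leq_sum.
Qed.
End Isomorphic.

Section SameDim.
Variables (M M' : rep G F alpha) (beta : V -> lattice -> nat).
Variables (J J' : forall i chi, 'M[F]_(beta i chi, alpha i)).
Variables (P P' : forall i chi, 'M[F]_(alpha i, beta i chi)) (X X' : seq lattice).
Hypotheses (gr : grading M J P X) (gr' : grading M' J' P' X').

(** For two gradings with the same dimensions, [no_shift] forces the translation
to be zero, so the degree zero part of the isomorphism is invertible. *)
Lemma iso_pieces : tracial (cov_seq V X) (piece M J P) -> isomorphic M M' ->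
  isomorphic (piece M J P) (piece M' J' P').
Proof.
move=> trN isoM; have [u [v [xi [hu hv nz]]]] := iso_degree_part gr gr' trN isoM.
have xi0 : xi = 0.
  have le_b := degree_part_dim gr gr' hu hv trN nz.
  exact: (no_shift gr (total_dim_gt0_of_piece gr trN) le_b).
pose f (x : V * lattice) := J x.1 x.2 *m u x.1 *m P' x.1 x.2.
have hf := hom_piece gr gr' hu.
have uf x : f x \in unitmx.
  have := degree_part_unit gr gr' hu hv trN nz x.
  by rewrite xi0 /degree_part addr0 unitmx_mul => /andP[].
exists f, (fun x => invmx (f x)); split=> [//|a|x|x].
- apply: (can_inj (mulmxK (uf (tgt cover a)))).
  rewrite mulmxKV // -mulmxA (hf a) mulmxA mulVmx ?mul1mx //.
- exact: mulmxV.
exact: mulVmx.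
Qed.

Lemma iso_push : isomorphic (piece M J P) (piece M' J' P') -> isomorphic M M'.
Proof.
case=> f [g [hf hg fg gf]].
exists (push P X J' f), (push P' X' J g); split.
- exact: push_hom gr gr' _ hf.
- exact: push_hom gr' gr _ hg.
- move=> i; apply: (eq_by_J gr) => c; rewrite mulmxA (J_push _ gr).
  by rewrite -mulmxA (J_push _ gr') mulmxA (fg (i, c)) mulmx1 mul1mx.
move=> i; apply: (eq_by_J gr') => c; rewrite mulmxA (J_push _ gr').
by rewrite -mulmxA (J_push _ gr) mulmxA (gf (i, c)) mulmx1 mul1mx.
Qed.
End SameDim.

Lemma grading_transport (M M' : rep G F alpha) beta
    (J : forall i chi, 'M[F]_(beta i chi, alpha i))
    (P : forall i chi, 'M[F]_(alpha i, beta i chi)) X :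
  isomorphic M M' -> grading M J P X ->
  exists J' P', @grading V A G alpha F M' beta J' P' X.
Proof.
case=> u [v [hu hv uv vu]] [uX JP1 JP0 PJ1 hom].
exists (fun i c => J i c *m u i), (fun i c => v i *m P i c); split=> //.
- by move=> i c; rewrite mulmxA -(mulmxA (J i c)) uv mulmx1 JP1.
- by move=> i c c' nc; rewrite mulmxA -(mulmxA (J i c)) uv mulmx1 JP0.
- move=> i; transitivity (v i *m (\sum_(c <- X) P i c *m J i c) *m u i).
    rewrite mulmx_sumr mulmx_suml; apply: eq_bigr => c _.
    by rewrite !mulmxA.
  by rewrite PJ1 mulmx1 vu.
move=> a c c' nc; rewrite -(mulmxA (J _ _)) -hu !mulmxA -(mulmxA _ (u _)).
by rewrite uv mulmx1 hom.
Qed.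
End Comparison.

(** * Constructing gradings *)

Section CoordinateBlocks.
Variables (F : fieldType) (I : eqType) (X : seq I) (b : I -> nat) (n : nat).
Hypotheses (uX : uniq X) (b0 : forall c, c \notin X -> b c = 0%N).
Hypothesis sumb : (\sum_(c <- X) b c)%N = n.

Let L := [seq (c, k) | c <- X, k <- iota 0 (b c)].

(** The coordinates of a space of dimension [n] are cut into consecutive blocks of
sizes [b c]; [L] lists the positions inside the blocks in order. *)
Definition blk_in (c : I) : 'M[F]_(b c, n) :=
  \matrix_(k, m) ((m : nat) == index (c, k : nat) L)%:R.
Definition blk_out (c : I) : 'M[F]_(n, b c) := (blk_in c)^T.

Lemma blocks_size : size L = n.
Proof.
rewrite -sumb size_allpairs_dep sumnE big_map; apply: eq_bigr => c _.
exact: size_iota.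
Qed.

Lemma blocks_uniq : uniq L.
Proof.
apply: allpairs_uniq_dep => // [c _|]; first exact: iota_uniq.
by move=> [c k] [c' k'] _ _ /= [-> ->].
Qed.

Lemma blocks_mem c (k : 'I_(b c)) : (c, k : nat) \in L.
Proof.
have cX : c \in X.
  by apply: contraT => /b0 bc; have := ltn_ord k; rewrite [X in (_ < X)%N]bc.
by apply/allpairsPdep; exists c, (k : nat); rewrite mem_iota ltn_ord.
Qed.

Lemma blk_in_out c c' (k : 'I_(b c)) (k' : 'I_(b c')) :
  (blk_in c *m blk_out c') k k' = ((c, k : nat) == (c', k' : nat))%:R.
Proof.
have lt : (index (c, k : nat) L < n)%N by rewrite -blocks_size index_mem blocks_mem.
rewrite mxE (bigD1 (Ordinal lt)) //= big1 ?addr0 => [|m nm]; last first.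
  by rewrite !mxE -val_eqE /= in nm *; rewrite (negbTE nm) mul0r.
rewrite !mxE eqxx mul1r /=; congr ((nat_of_bool _)%:R); apply/eqP/eqP => [eqi|-> //].
by rewrite -(nth_index (c, k : nat) (blocks_mem k)) eqi nth_index ?blocks_mem.
Qed.

Lemma blk_in_out1 c : blk_in c *m blk_out c = 1%:M.
Proof. by apply/matrixP => k k'; rewrite blk_in_out mxE xpair_eqE eqxx. Qed.

Lemma blk_in_out0 c c' : c != c' -> blk_in c *m blk_out c' = 0.
Proof.
by move=> nc; apply/matrixP => k k'; rewrite blk_in_out mxE xpair_eqE (negbTE nc).
Qed.

(** Both sides have at [(m, m')] the number of indices [t] with [m = t = m']. *)
Lemma blk_out_in : \sum_(c <- X) blk_out c *m blk_in c = 1%:M.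
Proof.
apply/matrixP => m m'; rewrite summxE mxE.
pose g t : F := ((m : nat) == t)%:R * ((m' : nat) == t)%:R.
transitivity (\sum_(y <- L) g (index y L)).
  rewrite big_allpairs_dep /=; apply: eq_bigr => c _.
  have -> : iota 0 (b c) = index_iota 0 (b c) by rewrite /index_iota subn0.
  by rewrite mxE big_mkord; apply: eq_bigr => k _; rewrite !mxE.
transitivity (\sum_(t < n) g t); last first.
  rewrite (bigD1 m) //= big1 ?addr0 => [|t nt]; last first.
    by rewrite /g eq_sym (negbTE (nt : (t : nat) != m)) mul0r.
  by rewrite /g eqxx mul1r eq_sym.
rewrite -blocks_size; case: (L) blocks_uniq => [|y0 L'] uL.
  by rewrite big_nil big_ord0.
rewrite (big_nth y0) big_mkord; apply: eq_bigr => t _.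
by rewrite index_uniq.
Qed.
End CoordinateBlocks.

Section Constructions.
Variables (V A : finType) (G : quiver V A) (alpha : V -> nat) (F : fieldType).
Local Notation lattice := {ffun A -> int}.
Local Notation cdim beta := (fun x : V * lattice => beta x.1 x.2).
Local Notation cover := (covering_quiver G).
Local Notation vs := (index_enum V).

(** The push-down of a representation of the covering quiver. *)
Lemma grading_exists (beta : V -> lattice -> nat) (X : seq lattice)
    (N : rep cover F (cdim beta)) :
  uniq X -> (forall i c, c \notin X -> beta i c = 0%N) ->
  (forall i, (\sum_(c <- X) beta i c)%N = alpha i) ->
  exists (M : rep G F alpha) J P, grading M J P X /\ forall a, piece M J P a = N a.
Proof.
move=> uX b0 sumb.
pose J i c : 'M[F]_(beta i c, alpha i) := blk_in F X (beta i) (alpha i) c.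
pose P i c : 'M[F]_(alpha i, beta i c) := blk_out F X (beta i) (alpha i) c.
have JP1 i c : J i c *m P i c = 1%:M by apply: blk_in_out1 => //; apply: b0.
have JP0 i c c' : c != c' -> J i c *m P i c' = 0.
  by move=> nc; apply: blk_in_out0 => //; apply: b0.
have PJ1 i : \sum_(c <- X) P i c *m J i c = 1%:M by apply: blk_out_in.
clearbody J P.
pose N' a c : 'M[F]_(beta (src G a) c, beta (tgt G a) (c + unit_vec a)) := N (a, c).
pose M : rep G F alpha := fun a =>
  \sum_(c <- X) P (src G a) c *m N' a c *m J (tgt G a) (c + unit_vec a).
have JM a c : J (src G a) c *m M a = N' a c *m J (tgt G a) (c + unit_vec a).
  rewrite mulmx_sumr (big_seq_only (i0 := c)) // => [|c' nc|/b0 bc].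
  - by rewrite !mulmxA JP1 mul1mx.
  - by rewrite !mulmxA JP0 ?mul0mx // eq_sym.
  by rewrite (eq_mx_dim0 (J _ _) 0 (bc _)) mul0mx.
exists M, J, P; split; first split=> //.
  by move=> a c c' nc; rewrite JM -mulmxA JP0 ?mulmx0 // eq_sym.
by move=> [a c]; rewrite /piece /graded_block /= JM -mulmxA JP1 mulmx1.
Qed.

Lemma grading_of_idem (M : rep G F alpha)
    (E : forall (i : V), lattice -> 'M[F]_(alpha i))
    (X : seq lattice) : uniq X ->
  (forall i c, E i c *m E i c = E i c) ->
  (forall i c c', c != c' -> E i c *m E i c' = 0) ->
  (forall i, \sum_(c <- X) E i c = 1%:M) ->
  (forall a c c', c' != c + unit_vec a ->
     E (src G a) c *m M a *m E (tgt G a) c' = 0) ->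
  exists beta J P, @grading V A G alpha F M beta J P X.
Proof.
move=> uX idE orthE sumE homE.
have [r [P [J [PJ JP]]]] := idem_split (fun x : V * lattice => idE x.1 x.2).
exists (fun i c => r (i, c)), (fun i c => J (i, c)), (fun i c => P (i, c)).
split; [exact: uX | by move=> i c; exact: (JP (i, c)) | move=> i c c' nc
  | move=> i | move=> a c c' nc].
- apply: (split_orth (JP (i, c)) (JP (i, c'))).
  by have /= -> := PJ (i, c); have /= -> := PJ (i, c'); apply: orthE.
- by rewrite -(sumE i); apply: eq_bigr => c _; exact: (PJ (i, c)).
have := homE a c c' nc.
have /= <- := PJ (src G a, c); have /= <- := PJ (tgt G a, c').
move/(congr1 (fun B => J (src G a, c) *m B *m P (tgt G a, c'))).
have /= J1 := JP (src G a, c); have /= J2 := JP (tgt G a, c').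
by rewrite mulmx0 mul0mx !mulmxA J1 mul1mx -!mulmxA J2 mulmx1 mulmxA.
Qed.

End Constructions.

(** * Lifting a cyclic grading to the lattice *)

Section Lifting.
Variables (V A : finType) (G : quiver V A) (alpha : V -> nat) (F : fieldType).
Local Notation lattice := {ffun A -> int}.
Local Notation vs := (index_enum V).
Let n := total_dim alpha vs.
Definition bounded (m : nat) (c : lattice) := forall a, (`|c a| <= m)%N.

Lemma bounded_add m (c : lattice) a : bounded m c -> bounded m.+1 (c + unit_vec a).
Proof.
move=> bc b; rewrite [(_ + _ : lattice) b]ffunE [unit_vec a b]ffunE.
by move: (bc b); move: (c b) => w; case: (b == a) => /=; lia.
Qed.

Lemma bounded_sub m (c : lattice) a : bounded m (c + unit_vec a) -> bounded m.+1 c.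
Proof.
move=> bc b; move: (bc b); rewrite [(_ + _ : lattice) b]ffunE [unit_vec a b]ffunE.
by move: (c b) => w; case: (b == a) => /=; lia.
Qed.

Variables (M : rep G F alpha) (E : forall i : V, lattice -> 'M[F]_(alpha i)).
Hypotheses (smallF : small_char F n) (trM : tracial vs M).
Hypothesis idE : forall i c, E i c *m E i c = E i c.
Hypothesis orthE : forall i c c', bounded n c -> bounded n c' -> c != c' ->
  E i c *m E i c' = 0.
Hypothesis homE : forall a c,
  M a *m E (tgt G a) (c + unit_vec a) = E (src G a) c *m M a.
Variable i0 : V.
Hypothesis E0 : E i0 0 != 0.

(** Such lists arise from [(i0, 0)] by following arrows in either direction
between nonzero parts: each new degree is adjacent to an old one, so it stays in
the box whose size is one less than the length of the list. *)
Definition patch (Q : seq (V * lattice)) :=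
  [/\ uniq Q, (i0, 0) \in Q, forall x, x \in Q -> E x.1 x.2 != 0
    & forall x, x \in Q -> bounded (size Q).-1 x.2].

Definition closed_patch (Q : seq (V * lattice)) := forall a c,
  ((src G a, c) \in Q -> E (tgt G a) (c + unit_vec a) != 0 ->
     (tgt G a, c + unit_vec a) \in Q) /\
  ((tgt G a, c + unit_vec a) \in Q -> E (src G a) c != 0 -> (src G a, c) \in Q).

(** The parts at the degrees of a patch are orthogonal and nonzero, since distinct
bounded degrees give orthogonal idempotents. *)
Lemma patch_size Q : patch Q -> (size Q <= n.+1)%N -> (size Q <= n)%N.
Proof.
move=> [uQ _ nzQ bQ] szQ.
have bQn x : x \in Q -> bounded n x.2.
  by move=> xQ a; apply: leq_trans (bQ x xQ a) _; rewrite -subn1 leq_subLR.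
apply: (@leq_trans (\sum_(x <- Q) \rank (E x.1 x.2))%N).
  rewrite -sum1_size big_seq [leqRHS]big_seq; apply: leq_sum => x xQ.
  by rewrite lt0n mxrank_eq0 nzQ.
rewrite (partition_big (fun x => x.1) xpredT) //=; apply: leq_sum => i _.
rewrite (eq_bigr (fun x => \rank (E i x.2))) => [|x /eqP <- //].
rewrite -big_filter -mxrank_orth_sum ?rank_leq_row ?filter_uniq // => x y.
rewrite !mem_filter => /andP[/eqP xi xQ] /andP[/eqP yi yQ] nxy.
apply: orthE; [exact: bQn | exact: bQn |].
apply: contra nxy => /eqP e2.
by rewrite [x]surjective_pairing [y]surjective_pairing xi yi e2.
Qed.

Lemma patch_grow Q : patch Q -> ~ closed_patch Q ->
  exists2 Q', patch Q' & size Q' = (size Q).+1.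
Proof.
move=> [uQ Q0 nzQ bQ] nclosed.
have szQ : (0 < size Q)%N by case: (Q) Q0.
suff [y [yQ nzy by_]] : exists y, [/\ y \notin Q, E y.1 y.2 != 0 & bounded (size Q) y.2].
  exists (y :: Q) => //; split=> [|||x] /=.
  - by rewrite yQ.
  - by rewrite inE Q0 orbT.
  - by move=> x; rewrite inE => /predU1P[->|/nzQ].
  rewrite inE => /predU1P[->//|xQ] a.
  exact: leq_trans (bQ x xQ a) (leq_pred _).
apply: contra_notP nclosed => none a c; split=> cQ nz; apply: contraT => nQ; case: none.
  exists (tgt G a, c + unit_vec a); split=> //.
  by rewrite -(prednK szQ); apply: bounded_add; apply: (bQ _ cQ).
exists (src G a, c); split=> //.
by rewrite -(prednK szQ); apply: bounded_sub; apply: (bQ _ cQ).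
Qed.

Lemma closed_patch_exists : exists Q, [/\ patch Q, closed_patch Q & (size Q <= n)%N].
Proof.
apply: contrapT => none.
have grow k : (k <= n)%N -> exists2 Q, patch Q & size Q = k.+1.
  elim: k => [_|k IH lekn].
    exists [:: (i0, 0)] => //; split=> //; first by rewrite inE.
      by move=> x; rewrite inE => /eqP ->.
    by move=> x; rewrite inE => /eqP -> a; rewrite ffunE.
  have [Q pQ szQ] := IH (ltnW lekn).
  have nclosed : ~ closed_patch Q.
    by move=> cQ; apply: none; exists Q; split=> //; rewrite szQ.
  by have [Q' pQ' szQ'] := patch_grow pQ nclosed; exists Q'; rewrite // szQ' szQ.
have [Q pQ szQ] := grow n (leqnn n).
by have := patch_size pQ; rewrite szQ leqnn ltnn => /(_ isT).
Qed.

(** In the intended situation [E i chi] is the projection to the eigenspace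
attached to [chi], so that [E i] is constant on the fibres of a character of the
lattice which is injective on small degrees.  A patch that cannot be extended
spans a nonzero direct summand of [M], that is all of [M]. *)
Lemma grading_lift : exists beta J P X,
  @grading V A G alpha F M beta J P X /\ forall c, c \in X -> bounded n c.
Proof.
have [Q [[uQ Q0 nzQ bQ] clQ szQ]] := closed_patch_exists.
have bQn i c : (i, c) \in Q -> bounded n c.
  by move=> /bQ b a; apply: leq_trans (b a) _; apply: leq_trans (leq_pred _) szQ.
pose X := undup [seq x.2 | x <- Q].
have uX : uniq X by exact: undup_uniq.
have inX i c : (i, c) \in Q -> c \in X.
  by move=> cQ; rewrite mem_undup; apply/mapP; exists (i, c).
have bX c : c \in X -> bounded n c.
  by rewrite mem_undup => /mapP[[i c'] /= /bQn b ->].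
clearbody X.
pose E' i c := if (i, c) \in Q then E i c else 0.
have idE' i c : E' i c *m E' i c = E' i c.
  by rewrite /E'; case: ifP; rewrite ?mulmx0.
have orthE' i c c' : c != c' -> E' i c *m E' i c' = 0.
  rewrite /E' => nc; case: ifP => [cQ|_]; last by rewrite mul0mx.
  case: ifP => [c'Q|_]; last by rewrite mulmx0.
  by apply: orthE => //; [exact: bQn cQ | exact: bQn c'Q].
pose T i := \sum_(c <- X) E' i c.
have E'T i c : (i, c) \in Q -> E i c *m T i = E i c /\ T i *m E i c = E i c.
  move=> cQ; have defE : E i c = E' i c by rewrite /E' cQ.
  rewrite defE mulmx_sumr mulmx_suml; split; rewrite (big_seq_only (i0 := c)) //.
  - by move=> c' nc; apply: orthE'; rewrite eq_sym.
  - by rewrite (inX _ _ cQ).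
  - by move=> c' nc; apply: orthE'.
  - by rewrite (inX _ _ cQ).
have idT i : T i *m T i = T i.
  rewrite {1 3}/T mulmx_suml; apply: eq_bigr => c _.
  rewrite /E'; case: ifP => [/E'T[] //|_]; by rewrite mul0mx.
(* [M] maps neither the image of [T] out of it, nor its complement into it. *)
have hT : is_hom M M T.
  move=> a; have eq1 : T (src G a) *m M a *m T (tgt G a) = T (src G a) *m M a.
    rewrite /T !mulmx_suml; apply: eq_bigr => c _; rewrite -/(T _) /E'.
    case: ifP => [cQ|_]; last by rewrite !mul0mx.
    rewrite -homE -mulmxA; congr (_ *m _).
    have [->|nz] := eqVneq (E (tgt G a) (c + unit_vec a)) 0; first by rewrite mul0mx.
    by have [] := E'T _ _ ((clQ a c).1 cQ nz).
  rewrite -eq1 -mulmxA /T !mulmx_sumr; apply: eq_bigr => c _; rewrite -/(T _) /E'.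
  case: ifP => [cQ|_]; last by rewrite !mulmx0.
  move: cQ; rewrite -[c](subrK (unit_vec a)) => cQ.
  rewrite homE mulmxA; congr (_ *m _).
  have [->|nz] := eqVneq (E (src G a) (c - unit_vec a)) 0; first by rewrite mulmx0.
  by have [] := E'T _ _ ((clQ a _).2 cQ nz).
have supV : supported alpha vs by move=> i; rewrite mem_index_enum.
have T1 : forall i, T i = 1%:M.
  have [T0|//] := tracial_idem supV smallF trM hT idT.
  by have [_] := E'T _ _ Q0; rewrite T0 mul0mx => z; move: E0; rewrite -z eqxx.
have [|beta [J [P gr]]] := grading_of_idem (M := M) uX idE' orthE' T1.
  move=> a c c' nc; rewrite /E'; case: ifP => [cQ|_]; last by rewrite !mul0mx.
  case: ifP => [c'Q|_]; last by rewrite mulmx0.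
  rewrite -homE -mulmxA.
  have [->|nz] := eqVneq (E (tgt G a) (c + unit_vec a)) 0; first by rewrite mul0mx mulmx0.
  have yQ := (clQ a c).1 cQ nz.
  by rewrite orthE ?mulmx0 //; [exact: bQn yQ | exact: bQn c'Q | rewrite eq_sym].
by exists beta, J, P, X.
Qed.
End Lifting.

(** * Scaling the arrows by roots of unity *)

Section Weights.
Variables (A : finType) (F : fieldType) (t : A -> F).
Hypothesis t_nz : forall a, t a != 0.
Local Notation lattice := {ffun A -> int}.

(** The character of the lattice with value [t a] at [unit_vec a]. *)
Definition weight (c : lattice) : F := \prod_a t a ^ c a.

Lemma weight_nz c : weight c != 0.
Proof. by apply/prodf_neq0 => a _; rewrite expfz_neq0. Qed.

Lemma weight0 : weight 0 = 1.
Proof. by apply: big1 => a _; rewrite ffunE expr0z. Qed.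

Lemma weightD c c' : weight (c + c') = weight c * weight c'.
Proof. by rewrite -big_split; apply: eq_bigr => a _; rewrite ffunE expfzDr. Qed.

Lemma weightB c c' : weight (c - c') = weight c / weight c'.
Proof. by apply: (mulIf (weight_nz c')); rewrite -weightD subrK divfK ?weight_nz. Qed.

Lemma weight_unit_vec a : weight (unit_vec a) = t a.
Proof.
rewrite /weight (bigD1 a) //= ffunE eqxx expr1z big1 ?mulr1 // => b nb.
by rewrite ffunE (negbTE nb) expr0z.
Qed.

Lemma weight_root l c : (forall a, t a ^+ l = 1) -> weight c ^+ l = 1.
Proof.
move=> tl; rewrite -prodrXl; apply: big1 => a _.
by rewrite exprnP exprz_exp mulrC -exprz_exp -exprnP tl exp1rz.
Qed.
End Weights.

Definition twist (V A : Type) (G : quiver V A) (F : fieldType) (d : V -> nat)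
  (t : A -> F) (M : rep G F d) : rep G F d := fun a => t a *: M a.

Section Twist.
Variables (V A : finType) (G : quiver V A) (alpha : V -> nat) (F : finFieldType).
Variable t : A -> F.
Hypothesis t_nz : forall a, t a != 0.
Local Notation lattice := {ffun A -> int}.

Lemma grading_twist (M : rep G F alpha) (beta : V -> lattice -> nat)
    (J : forall i chi, 'M[F]_(beta i chi, alpha i))
    (P : forall i chi, 'M[F]_(alpha i, beta i chi)) X :
  grading M J P X -> grading (twist t M) J P X.
Proof.
case=> uX JP1 JP0 PJ1 hom; split=> // a c c' nc.
by rewrite /twist -scalemxAr -scalemxAl hom // scaler0.
Qed.

(** Multiply the part of degree [chi] by [weight t chi]. *)
Lemma graded_twist_iso (M : rep G F alpha) (beta : V -> lattice -> nat)
    (J : forall i chi, 'M[F]_(beta i chi, alpha i))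
    (P : forall i chi, 'M[F]_(alpha i, beta i chi)) X :
  grading M J P X -> isomorphic M (twist t M).
Proof.
move=> gr; apply: (iso_push gr (grading_twist gr)).
pose w (x : V * lattice) := weight t x.2.
have blockE a c : graded_block (twist t M) J P a c = t a *: graded_block M J P a c.
  by rewrite /graded_block /twist -scalemxAr -scalemxAl.
exists (fun x => (w x)%:M), (fun x => (w x)^-1%:M); split=> [[a c]|[a c]|x|x].
- rewrite /piece /= blockE mul_mx_scalar mul_scalar_mx scalerA /w /=.
  by rewrite (weightD t_nz) weight_unit_vec.
- rewrite /piece /= blockE mul_mx_scalar mul_scalar_mx !scalerA /w /=.
  by rewrite (weightD t_nz) weight_unit_vec invfM mulfVK.
- by rewrite -scalar_mxM mulfV ?weight_nz.
by rewrite -scalar_mxM mulVf ?weight_nz.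
Qed.

End Twist.

Lemma root1_neq0 (F : fieldType) (z : F) l : (0 < l)%N -> z ^+ l = 1 -> z != 0.
Proof.
move=> l0; apply: contra_eq_neq => ->.
by rewrite expr0n gtn_eqF // eq_sym oner_eq0.
Qed.

Section FourierProjector.
Variables (F : fieldType) (l n : nat) (f : 'M[F]_n).
Hypotheses (l_nz : l%:R != 0 :> F) (l_gt0 : (0 < l)%N) (fl : f ^+ l = 1%:M).

(** The projection to the [z]-eigenspace of [f], for [f ^+ l = 1]. *)
Definition proj (z : F) : 'M[F]_n := l%:R^-1 *: \sum_(s < l) z^-1 ^+ s *: f ^+ s.

Lemma expS_mx m : f ^+ m.+1 = f *m f ^+ m. Proof. by rewrite exprS. Qed.

Lemma mul_proj z : z ^+ l = 1 -> f *m proj z = z *: proj z.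
Proof.
move=> zl; have znz := root1_neq0 l_gt0 zl.
rewrite /proj -scalemxAr scalerA mulrC -scalerA; congr (_ *: _).
pose g s := z^-1 ^+ s *: f ^+ s.
have gl : g l = g 0%N by rewrite /g exprVn zl invr1 fl !expr0.
transitivity (z *: \sum_(s < l) g s.+1).
  rewrite mulmx_sumr scaler_sumr; apply: eq_bigr => s _.
  by rewrite /g -scalemxAr -expS_mx scalerA (exprS z^-1) mulrA mulfV // mul1r.
congr (_ *: _); case: l l_gt0 gl => // k _ gl.
by rewrite big_ord_recr [RHS]big_ord_recl /= gl addrC.
Qed.

Lemma exp_mul_proj z s : z ^+ l = 1 -> f ^+ s *m proj z = z ^+ s *: proj z.
Proof.
move=> zl; elim: s => [|s IH]; first by rewrite !expr0 mul1mx scale1r.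
by rewrite exprSr -[_ * _]/(_ *m _) -mulmxA mul_proj // -scalemxAr IH scalerA -exprS.
Qed.

(** The sum of the powers of [z / z'] vanishes unless [z = z']. *)
Lemma proj_orth z z' : z ^+ l = 1 -> z' ^+ l = 1 ->
  proj z' *m proj z = if z == z' then proj z else 0.
Proof.
move=> zl zl'; have z'nz := root1_neq0 l_gt0 zl'.
have -> : proj z' *m proj z = (l%:R^-1 * \sum_(s < l) (z / z') ^+ s) *: proj z.
  rewrite {1}/proj -scalemxAl mulmx_suml -scalerA scaler_suml; congr (_ *: _).
  apply: eq_bigr => s _; rewrite -scalemxAl exp_mul_proj // scalerA.
  by rewrite -exprMn mulrC.
case: eqVneq => [->|nz].
  rewrite divff // (eq_bigr (fun=> 1)) => [|s _]; last by rewrite expr1n.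
  by rewrite sumr_const card_ord mulVf // scale1r.
have : (z / z') ^+ l - 1 = 0 by rewrite expr_div_n zl zl' divr1 subrr.
rewrite subrX1 => /eqP; rewrite mulf_eq0 subr_eq0 => /orP[|/eqP ->].
  by rewrite -(inj_eq (mulIf z'nz)) divfK // mul1r (negbTE nz).
by rewrite mulr0 scale0r.
Qed.

(** Summing over the powers of [zeta], the coefficient of [f ^+ s] is a geometric
sum that vanishes for [0 < s < l]. *)
Lemma sum_proj zeta : l.-primitive_root zeta ->
  \sum_(k < l) proj (zeta ^+ k) = 1%:M.
Proof.
move=> pz; rewrite -scaler_sumr exchange_big /=.
case: l l_gt0 l_nz pz => // k _ k_nz pz; rewrite big_ord_recl.
rewrite [X in _ + X]big1 ?addr0 => [|s _]; last first.
  rewrite -scaler_suml; set S := \sum_(i < k.+1) _.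
  have -> : S = \sum_(i < k.+1) (zeta ^- s.+1) ^+ i.
    apply: eq_bigr => i _; rewrite !exprVn -!exprM mulnC //.
  have := prim_expr_order pz.
  have nz1 : zeta ^- s.+1 != 1.
    by rewrite invr_eq1 -(prim_order_dvd pz) gtnNdvd // ltnS ltn_ord.
  move=> zk; have : (zeta ^- s.+1) ^+ k.+1 - 1 = 0.
    by rewrite exprVn -exprM mulnC exprM zk expr1n invr1 subrr.
  rewrite subrX1 => /eqP; rewrite mulf_eq0 subr_eq0 (negbTE nz1) /= => /eqP ->.
  by rewrite scale0r.
rewrite expr0 (eq_bigr (fun=> 1)) => [|i _]; last by rewrite expr0 scale1r.
by rewrite sumr_const card_ord -scaler_nat scalerA mulVf // scale1r.
Qed.

End FourierProjector.

Lemma exp_pchar_subC (F : fieldType) (p n : nat) (B : 'M[F]_n) (c : F) k :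
  p \in [pchar F] -> (B - c%:M) ^+ (p ^ k) = B ^+ (p ^ k) - (c ^+ (p ^ k))%:M.
Proof.
case: n B => [|n] B pF; first exact: eq_mx_dim0.
have pM : p \in [pchar 'M[F]_n.+1] := rmorph_pchar (@scalar_mx F n.+1) pF.
elim: k => [|k IH]; first by rewrite !expr1.
rewrite expnSr !exprM IH -!(pFrobenius_autE pM) pFrobenius_autB_comm.
  by rewrite !pFrobenius_autE scalar_mx_exp.
exact: comm_mx_scalar.
Qed.

Lemma prod_det_exp (F : fieldType) (V : finType) (alpha : V -> nat)
    (f : forall i, 'M[F]_(alpha i)) l (c : F) :
  (forall i, f i ^+ l = c%:M) ->
  (\prod_i \det (f i)) ^+ l = c ^+ total_dim alpha (index_enum V).
Proof.
move=> fl; rewrite -prodrXl /total_dim -prodrXr; apply: eq_bigr => i _.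
rewrite -[RHS]det_scalar -(fl i); elim: l {fl} => [|l IH]; rewrite ?det1 //.
by rewrite !exprS det_mulmx IH.
Qed.

(** A Bezout relation between [m] and [l]. *)
Lemma root_of_coprime_power (F : fieldType) (c D : F) m l : c != 0 -> (0 < m)%N ->
  coprime m l -> D ^+ l = c ^+ m -> exists b, b ^+ l = c.
Proof.
move=> cnz m0 cop Dl; case: (egcdnP l m0) => km kn eqm _.
move: eqm; rewrite (eqP cop) => eqm.
exists (D ^+ km / c ^+ kn); rewrite expr_div_n -exprM mulnC exprM Dl -!exprM mulnC.
by rewrite eqm addn1 exprS mulfK // expf_neq0.
Qed.

Lemma fermat_exp p l k : prime l -> coprime p l -> ((p ^ (l.-1 * k)) %% l = 1)%N.
Proof.
move=> pl cop; have l1 := prime_gt1 pl.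
rewrite expnM -modnXm -totient_prime // Euler_exp_totient // modnXm exp1n.
exact: modn_small.
Qed.

Section FixedLift.
Variables (V A : finType) (G : quiver V A) (alpha : V -> nat) (F : finFieldType).
Local Notation lattice := {ffun A -> int}.
Local Notation vs := (index_enum V).
Let n := total_dim alpha vs.
Variables (p l : nat) (t : A -> F) (zeta : F).
Hypotheses (smallF : small_char F n) (pF : p \in [pchar F]) (pr_l : prime l).
Hypotheses (cop : coprime p l) (nl : (n < l)%N) (prim : l.-primitive_root zeta).
Hypotheses (t_nz : forall a, t a != 0) (tl : forall a, t a ^+ l = 1).
Hypothesis generic : forall c : lattice, bounded (n + n) c -> weight t c = 1 -> c = 0.
Variable M : rep G F alpha.

(** Homomorphisms from [M] to its twist by [s], as seen on the spaces of [M]. *)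
Definition semi_endo (s : A -> F) (f : forall i, 'M[F]_(alpha i)) :=
  forall a, M a *m f (tgt G a) = s a *: (f (src G a) *m M a).

Lemma semi_endo_exp s f m : semi_endo s f ->
  semi_endo (fun a => s a ^+ m) (fun i => f i ^+ m).
Proof.
move=> hf a; elim: m => [|m IH]; first by rewrite expr0 mulmx1 mul1mx scale1r.
rewrite !exprS -![_ * _ ^+ m in LHS]/(_ *m _) mulmxA hf -scalemxAl -mulmxA IH.
by rewrite -scalemxAr mulmxA scalerA.
Qed.

Lemma semi_endo_scale s b f : semi_endo s f -> semi_endo s (fun i => b *: f i).
Proof.
by move=> hf a; rewrite -scalemxAr hf -scalemxAl !scalerA mulrC.
Qed.

Hypothesis trM : tracial vs M.

(** Let [f] be an isomorphism from [M] to its twist.  As [t ^ l = 1], the power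
[f ^ l] is an endomorphism, hence the sum of a scalar and a nilpotent.  Raising
[f] to a large power [q] of [p] that is 1 modulo [l] kills the nilpotent part and
does not change the twist.  The remaining scalar [mu] has an l-th root in [F],
because [mu ^ n] is the l-th power of a determinant and [n] is prime to [l]. *)
Lemma semi_endo_normalize : isomorphic M (twist t M) ->
  exists2 f, semi_endo t f & forall i, f i ^+ l = 1%:M.
Proof.
case=> f [g [hf _ fg _]].
have sf : semi_endo t f by move=> a; rewrite hf -scalemxAr.
have uf i : f i \in unitmx by have [] := mulmx1_unit (fg i).
have N0 : (0 < n)%N by case: trM.
have supV : supported alpha vs by move=> i; rewrite mem_index_enum.
have nnz : n%:R != 0 :> F by rewrite smallF // N0 leqnn.
pose h i := f i ^+ l.
have hh : is_hom M M h.
  by move=> a; rewrite (semi_endo_exp l sf) tl scale1r.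
pose lam := total_trace vs h / n%:R.
have hx : is_hom M M (fun i => h i - lam%:M).
  by apply: is_hom_add => //; apply/is_hom_opp/is_hom_scalar.
have tx : total_trace vs (fun i => h i - lam%:M) = 0.
  rewrite total_trace_add total_trace_opp total_trace_scalar -/n.
  by rewrite -[lam *+ n]mulr_natr divfK ?subrr.
have [[]|[_ [m nilx]]] := tracial_dichotomy supV smallF trM hx.
  by rewrite tx eqxx.
have p_pr : prime p := pcharf_prime pF.
have l1 := prime_gt1 pr_l.
(* The exponent is at least [m], and a multiple of [l - 1] so that [q] is 1
   modulo [l] by Fermat's little theorem. *)
pose q := (p ^ (l.-1 * m))%N.
have le_mq : (m <= q)%N.
  apply: leq_trans (_ : p ^ m <= _)%N; first exact/ltnW/ltn_expl/prime_gt1.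
  by rewrite leq_exp2l ?prime_gt1 // leq_pmull // -subn1 subn_gt0.
have qE : (q %% l = 1)%N by apply: fermat_exp.
pose mu := lam ^+ q.
have hq i : h i ^+ q = mu%:M.
  have z : (h i - lam%:M) ^+ q = 0.
    by rewrite -(subnKC le_mq) exprD nilx -[_ * _]/(_ *m _) mul0mx.
  by apply/eqP; rewrite -subr_eq0 -(exp_pchar_subC (h i) lam _ pF) -/q z.
pose f1 i := f i ^+ q.
have sf1 : semi_endo t f1.
  move=> a; have tq : t a ^+ q = t a.
    by rewrite (divn_eq q l) qE exprD mulnC exprM tl expr1n mul1r expr1.
  by rewrite (semi_endo_exp q sf) tq.
have f1l i : f1 i ^+ l = mu%:M by rewrite -hq -!exprM mulnC.
have [i0 ai0] := (total_dim_gt0P supV).1 N0.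
have munz : mu != 0.
  apply/eqP => mu0; apply: ai0; have := unitmx_exp l (unitmx_exp q (uf i0)).
  have z0 : (0%:M : 'M[F]_(alpha i0)) = 0 by apply/matrixP=> x y; rewrite !mxE mul0rn.
  by rewrite -/(f1 i0) f1l mu0 z0 -row_free_unit /row_free mxrank0 => /eqP.
have [b bl] : exists b, b ^+ l = mu.
  apply: (root_of_coprime_power munz N0 _ (prod_det_exp f1l)).
  rewrite coprime_sym prime_coprime //; apply: contraL nl => /dvdn_leq -/(_ N0).
  by rewrite -leqNgt.
exists (fun i => b^-1 *: f1 i); first exact: semi_endo_scale.
have bnz : b != 0.
  by apply: contraNneq munz => b0; rewrite -bl b0 expr0n gtn_eqF ?prime_gt0.
move=> i; have -> : (b^-1 *: f1 i) ^+ l = b^-1 ^+ l *: f1 i ^+ l.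
  elim: (l) => [|k IH]; first by rewrite !expr0 scale1r.
  by rewrite !exprS -[LHS]/(_ *m _) IH -scalemxAl -scalemxAr scalerA.
by rewrite f1l scale_scalar_mx exprVn bl mulVf.
Qed.

(** Multiplying the character [weight t] by a fixed eigenvalue [w] of [f] at [i0]
makes the part of degree zero at [i0] nonzero. *)
Lemma fixed_grading : isomorphic M (twist t M) -> exists beta J P X,
  @grading V A G alpha F M beta J P X /\ forall c, c \in X -> bounded n c.
Proof.
move=> /semi_endo_normalize[f sf fl].
have l0 := prime_gt0 pr_l.
have lnz : l%:R != 0 :> F.
  rewrite -(dvdn_pcharf pF) -prime_coprime ?(pcharf_prime pF) //.
have supV : supported alpha vs by move=> i; rewrite mem_index_enum.
have N0 : (0 < n)%N by case: trM.
have [i0 ai0] := (total_dim_gt0P supV).1 N0.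
have [k nzk] : exists k : 'I_l, proj l (f i0) (zeta ^+ k) != 0.
  apply/existsP; apply: contraT; rewrite negb_exists => /forallP z.
  have := sum_proj (f i0) lnz l0 prim.
  rewrite big1 => [/(congr1 mxrank)|j _]; last by apply/eqP/negPn/z.
  by rewrite mxrank0 mxrank1 => e; rewrite -e in ai0.
pose w := zeta ^+ k.
have wl : w ^+ l = 1 by rewrite -exprM mulnC exprM (prim_expr_order prim) expr1n.
have wnz : w != 0 := root1_neq0 l0 wl.
pose E i c := proj l (f i) (w * weight t c).
have Wl c : (w * weight t c) ^+ l = 1 by rewrite exprMn wl (weight_root _ tl) mulr1.
apply: (grading_lift (E := E) smallF trM _ _ _ (i0 := i0)).
- by move=> i c; rewrite /E proj_orth ?eqxx.
- move=> i c c' bc bc' nc; rewrite /E proj_orth //; case: eqP => // eqw.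
  case/eqP: nc; apply/eqP; rewrite eq_sym -subr_eq0; apply/eqP.
  apply: generic; last first.
    by rewrite weightB // (mulfI wnz eqw) divff // weight_nz.
  move=> a; move: (bc a) (bc' a); rewrite [(_ - _ : lattice) a]ffunE.
  by rewrite [(- _ : lattice) a]ffunE; move: (c a) (c' a) => x y; rewrite -/n; lia.
- move=> a c; rewrite /E /proj -!scalemxAr -!scalemxAl; congr (_ *: _).
  rewrite mulmx_sumr mulmx_suml; apply: eq_bigr => s _.
  rewrite -scalemxAr (semi_endo_exp s sf) scalerA -scalemxAl; congr (_ *: _).
  rewrite (weightD t_nz) weight_unit_vec -exprMn mulrA invfM mulfVK //.
by rewrite /E weight0 mulr1.
Qed.
End FixedLift.

(** * Weights injective on a box, and congruences at one *)

(** The lowest digit is divisible by [B] and smaller than [B] in absolute value. *)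
Lemma balanced_digits (B m : nat) (x : nat -> int) :
  (forall k, `|x k| < B)%N -> \sum_(k < m) x k * (B ^ k)%N%:Z = 0 ->
  forall k, (k < m)%N -> x k = 0.
Proof.
elim: m x => [//|m IH] x xB.
rewrite big_ord_recl expn0 mulr1 => sum0.
pose S := \sum_(k < m) x k.+1 * (B ^ k)%N%:Z.
have eqS : x 0%N + B%:Z * S = 0.
  rewrite -[RHS]sum0; congr (_ + _); rewrite mulr_sumr; apply: eq_bigr => k _.
  by rewrite lift0 expnS PoszM mulrCA.
have S0 : S = 0 by have := xB 0%N; nia.
have x0 : x 0%N = 0 by rewrite S0 in eqS; lia.
case=> [//|k]; rewrite ltnS => km.
exact: (IH (fun k => x k.+1)).
Qed.

Section GenericWeights.
Variables (A : finType) (F : fieldType) (n l : nat) (zeta : F).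
Local Notation lattice := {ffun A -> int}.
Let B := (n + n).+1.

(** The largest value of the sum of the [c a * B ^ enum_rank a] for [c] with
coordinates bounded by [n + n]. *)
Definition generic_bound := (\sum_(k < #|A|) (n + n) * B ^ k)%N.

Definition generic_weight (a : A) : F := zeta ^+ (B ^ enum_rank a).

Hypothesis (prim : l.-primitive_root zeta) (big_l : (generic_bound < l)%N).

Lemma generic_weight_root a : generic_weight a ^+ l = 1.
Proof. by rewrite -exprM mulnC exprM (prim_expr_order prim) expr1n. Qed.

Lemma generic_weight_nz a : generic_weight a != 0.
Proof. exact: root1_neq0 (prim_order_gt0 prim) (generic_weight_root a). Qed.

(** The weight of [c] is [zeta ^ z] for the integer [z] with balanced digits [c a]
in base [B]; [z] is divisible by [l] and smaller than [l], hence zero. *)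
Lemma weight_generic c : bounded (n + n) c -> weight generic_weight c = 1 -> c = 0.
Proof.
move=> bc; pose x k := if insub k is Some o then c (@enum_val _ A o) else 0.
have xE (o : 'I_#|A|) : x o = c (enum_val o) by rewrite /x valK.
pose z := \sum_(k < #|A|) x k * (B ^ k)%N%:Z.
have zeta_nz : zeta != 0 := root1_neq0 (prim_order_gt0 prim) (prim_expr_order prim).
have -> : weight generic_weight c = zeta ^ z.
  rewrite /z (big_morph (fun y => zeta ^ y) (id1 := 1) (op1 := *%R)) //; last first.
    by move=> u v; apply: expfzDr.
  rewrite /weight (eq_bigl (mem A)) // big_enum_val; apply: eq_bigr => o _.
  by rewrite /generic_weight enum_valK exprnP exprz_exp xE mulrC.
have xb k : (`|x k| <= n + n)%N by rewrite /x; case: insubP.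
have z_small : (`|z| < l)%N.
  apply: leq_ltn_trans big_l; rewrite -lez_nat abszE.
  apply: Order.POrderTheory.le_trans (ler_norm_sum _ _ _) _.
  rewrite /generic_bound -[X in _ <= X]/(Posz _).
  rewrite (big_morph Posz PoszD (erefl _)).
  apply: ler_sum => k _; rewrite normrM -!abszE absz_nat -PoszM lez_nat.
  by rewrite leq_mul2r xb orbT.
move=> zz; have : zeta ^+ `|z|%N = 1.
  by case: (z) zz => m //= zm; apply: invr_inj; rewrite invr1.
move/eqP; rewrite -(prim_order_dvd prim) => /dvdn_leq l_le.
have z0 : z = 0.
  apply/eqP; rewrite -absz_eq0; apply: contraTT z_small => nz.
  by rewrite -leqNgt l_le // lt0n.
apply/ffunP => a; rewrite ffunE -(enum_rankK a) -xE.
by apply: (balanced_digits (m := #|A|) _ z0) => [k|]; rewrite ?ltnS.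
Qed.
End GenericWeights.

(** Cauchy's theorem in the group of units. *)
Lemma prim_root_finField (F : finFieldType) l : prime l -> (l %| #|F|.-1)%N ->
  exists zeta : F, l.-primitive_root zeta.
Proof.
move=> pl; rewrite -card_finField_unit => /(Cauchy (G := [set: {unit F}]%G) pl)[u _ ou].
have ul : (val u) ^+ l = 1 :> F by rewrite -FinRing.val_unitX -ou expg_order.
have [m pm ml] := prim_order_exists (prime_gt0 pl) ul.
exists (val u); have /primeP[_ /(_ m ml)] := pl.
case/orP=> /eqP m1; last by rewrite -m1.
move: pm; rewrite m1 => /prim_expr_order; rewrite expr1 => u1.
have : u = 1%g by apply: val_inj.
by move=> u1'; move: ou pl; rewrite u1' order1 => <-.
Qed.

(** ['X - 1] divides [P - P.[1]] over the integers. *)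
Lemma horner_int_congr (P : {poly int}) (q l : nat) : (0 < q)%N -> (l %| q.-1)%N ->
  exists y, P.[q%:Z] = P.[1] + l%:Z * y.
Proof.
move=> q0 lq; have /factor_theorem[Q eqP] : root (P - (P.[1])%:P) 1.
  by rewrite rootE !hornerE subrr.
have := congr1 (horner^~ q%:Z) eqP; rewrite !hornerE => eqq.
case/dvdnP: lq => k defq; exists (Q.[q%:Z] * k%:Z).
have -> : P.[q%:Z] = P.[1] + Q.[q%:Z] * (q%:Z - 1) by rewrite -eqq addrC subrK.
congr (_ + _); rewrite [RHS]mulrCA; congr (_ * _).
by rewrite -PoszM mulnC -defq; lia.
Qed.

(** * Counting isomorphism classes modulo a prime *)

Lemma twist_hom (V A : Type) (G : quiver V A) (F : fieldType) (d e : V -> nat)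
    (t : A -> F) (M : rep G F d) (N : rep G F e) f : (forall a, t a != 0) ->
  is_hom (twist t M) (twist t N) f <-> is_hom M N f.
Proof.
move=> tnz; split=> hf a; last by rewrite -scalemxAl -scalemxAr hf.
by apply: (scalerI (tnz a)); have := hf a; rewrite -scalemxAl -scalemxAr.
Qed.

Lemma twist_iso (V A : Type) (G : quiver V A) (F : fieldType) (d e : V -> nat)
    (t : A -> F) (M : rep G F d) (N : rep G F e) : (forall a, t a != 0) ->
  isomorphic (twist t M) (twist t N) <-> isomorphic M N.
Proof.
move=> tnz; split=> -[f [g [hf hg fg gf]]]; exists f, g; split=> //.
- exact/(twist_hom _ _ _ tnz).
- exact/(twist_hom _ _ _ tnz).
- exact/(twist_hom _ _ _ tnz).
exact/(twist_hom _ _ _ tnz).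
Qed.

Lemma twist_twist (V A : Type) (G : quiver V A) (F : fieldType) (d : V -> nat)
    (t u : A -> F) (M : rep G F d) :
  twist t (twist u M) = twist (fun a => t a * u a) M.
Proof. by apply: functional_extensionality_dep => a; rewrite /twist scalerA. Qed.

Lemma twist_tracial (V : eqType) (A : Type) (G : quiver V A) (F : fieldType)
    (d : V -> nat) (s : seq V) (t : A -> F) (M : rep G F d) :
  (forall a, t a != 0) -> tracial s M -> tracial s (twist t M).
Proof.
move=> tnz [N0 trM]; split=> // f g.
by move=> /(twist_hom _ _ _ tnz) hf /(twist_hom _ _ _ tnz) hg; apply: trM.
Qed.

(** The orbits of an action of a group of prime power order have prime power
length. *)
Lemma card_fix_perm_mod (T : finType) (s : {perm T}) l : prime l ->
  (s ^+ l)%g = 1%g -> #|T| = #|[set x | s x == x]| %[mod l].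
Proof.
move=> pl sl.
have lG : l.-group%g <[s]>%g.
  rewrite /pgroup -orderE; apply: (@pnat_dvd _ l); last by rewrite pnat_id.
  by rewrite order_dvdn sl.
have acts : [acts <[s]>%g, on [set: T] | 'P]%g
  by apply/actsP=> x _ y; rewrite !inE.
have := pgroup_fix_mod lG acts; rewrite cardsT => ->; congr (_ %% _)%N.
rewrite finset.setTI afix_cycle; apply: eq_card => x; rewrite [RHS]inE.
by apply/afix1P/eqP.
Qed.

Section Count.
Variables (V A : finType) (G : quiver V A) (alpha : V -> nat).
Local Notation lattice := {ffun A -> int}.
Local Notation cover := (covering_quiver G).
Local Notation vs := (index_enum V).
Local Notation n := (total_dim alpha vs).
Local Notation dims beta := (fun i c => fun_of_fsfun beta (i, c)).
Implicit Types beta gamma : cov_dimvec V A.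

Definition sites beta : seq lattice := undup [seq x.2 | x <- finsupp beta].

Lemma sites_uniq beta : uniq (sites beta). Proof. exact: undup_uniq. Qed.

Lemma sites0 beta i c : c \notin sites beta -> beta (i, c) = 0%N.
Proof.
move=> nc; apply: fsfun_dflt; apply: contra nc => ic.
by rewrite mem_undup; apply/mapP; exists (i, c).
Qed.

(** Compatibility as the condition under which [grading_exists] applies. *)
Lemma compatibleP beta (X : seq lattice) : uniq X ->
  (forall i c, c \notin X -> beta (i, c) = 0%N) ->
  compatible alpha beta <-> forall i, (\sum_(c <- X) beta (i, c))%N = alpha i.
Proof.
move=> uX X0.
suff eqs i : (\sum_(x <- finsupp beta | x.1 == i) beta x =
              \sum_(c <- X) beta (i, c))%N by split=> h i; rewrite -(h i) eqs.
rewrite -big_filter -[RHS](big_map (fun c => (i, c)) xpredT beta).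
rewrite -[RHS](@big_rmcond _ _ _ _ _ (fun x => x \in finsupp beta)); last first.
  by move=> x; apply: fsfun_dflt.
rewrite -[RHS]big_filter; apply: perm_big; apply: uniq_perm.
- by rewrite filter_uniq // fset_uniq.
- by rewrite filter_uniq // map_inj_uniq // => c c' [].
move=> [j c]; rewrite !mem_filter /= andbC; case inS: ((j, c) \in finsupp beta) => //=.
apply/eqP/mapP => [ji|[c' _ [] //]]; exists c; last by rewrite ji.
apply: contraT => /(X0 j) b0; move: inS.
by rewrite mem_finsupp b0 eqxx.
Qed.

Variable F : finFieldType.
Hypothesis smallF : small_char F n.
Local Notation cdims beta := (fun x : V * lattice => fun_of_fsfun beta (x.1, x.2)).

Lemma supported_finite : supported alpha vs.
Proof. by move=> i; rewrite mem_index_enum. Qed.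

Lemma num_abs_indec_cdims beta m :
  num_abs_indec cover F beta m -> num_abs_indec cover F (cdims beta) m.
Proof.
have -> // : cdims beta = beta :> (_ -> nat).
by apply: functional_extensionality_dep => -[].
Qed.

Lemma abs_indecomposable_piece (M : rep G F alpha) (beta : V -> lattice -> nat)
    (J : forall i chi, 'M[F]_(beta i chi, alpha i))
    (P : forall i chi, 'M[F]_(alpha i, beta i chi)) X :
  grading M J P X -> abs_indecomposable M -> tracial (cov_seq V X) (piece M J P) /\
  abs_indecomposable (piece M J P).
Proof.
move=> gr /(abs_indecomposable_tracial supported_finite smallF) trM.
have trN := tracial_piece gr trM; split=> //.
apply: (tracial_abs_indecomposable (grading_supported gr)) => //.
exact: small_cov gr.
Qed.

Lemma abs_indecomposable_push beta (N : rep cover F (cdims beta)) :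
  compatible alpha beta -> abs_indecomposable N ->
  exists (M : rep G F alpha) (J : forall i c, 'M[F]_(beta (i, c), alpha i))
    (P : forall i c, 'M[F]_(alpha i, beta (i, c))),
  [/\ grading (beta := dims beta) M J P (sites beta),
      piece (beta := dims beta) M J P = N & abs_indecomposable M].
Proof.
move=> /(compatibleP (sites_uniq beta) (@sites0 beta)) cb aiN.
have [M [J [P [gr eqN]]]] :=
  grading_exists (beta := dims beta) N (sites_uniq beta) (@sites0 beta) cb.
have {}eqN : piece M J P = N by apply: functional_extensionality_dep.
exists M, J, P; split=> //; apply: (tracial_abs_indecomposable supported_finite) => //.
apply: (tracial_of_piece smallF gr); rewrite eqN.
apply: abs_indecomposable_tracial aiN; first exact: grading_supported gr.
exact: small_cov gr.
Qed.

Definition graded_dims (d : V -> lattice -> nat) (M : rep G F alpha) : Prop :=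
  exists J P X, @grading V A G alpha F M d J P X.

Definition graded_by beta (M : rep G F alpha) : Prop := graded_dims (dims beta) M.

(** The uniqueness of gradings, applied to two gradings of the same [M]. *)
Lemma graded_by_translates beta gamma (M : rep G F alpha) : abs_indecomposable M ->
  graded_by beta M -> graded_by gamma M -> translates gamma beta.
Proof.
move=> aiM [J [P [X gr]]] [J' [P' [X' gr']]].
have [trN _] := abs_indecomposable_piece gr aiM.
have [xi e] := iso_graded_shift smallF gr gr' trN (isomorphic_refl M).
by exists xi.
Qed.

Section Classes.
Variables (m : nat) (r : 'I_m -> rep G F alpha).
Hypothesis r_ai : forall i, abs_indecomposable (r i).
Hypothesis r_inj : forall i j, isomorphic (r i) (r j) -> i = j.
Hypothesis r_all : forall M : rep G F alpha, abs_indecomposable M ->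
  exists i, isomorphic M (r i).

(** The classes of representations of the quiver that are push-downs from the
dimension vector [beta]. *)
Definition graded_classes beta : {set 'I_m} := [set k | `[< graded_by beta (r k) >]].

Lemma graded_classesP beta k :
  reflect (graded_by beta (r k)) (k \in graded_classes beta).
Proof. by rewrite /graded_classes finset.in_set; apply: asboolP. Qed.

(** Push-down is a bijection on isomorphism classes. *)
Lemma card_graded_classes beta k : compatible alpha beta ->
  num_abs_indec cover F beta k -> #|graded_classes beta| = k.
Proof.
move=> cb /num_abs_indec_cdims [q [q_ai q_inj q_all]].
have ex_g (a : 'I_k) : exists b : 'I_m, exists (M : rep G F alpha)
    (J : forall i c, 'M[F]_(beta (i, c), alpha i))
    (P : forall i c, 'M[F]_(alpha i, beta (i, c))),
    [/\ grading (beta := dims beta) M J P (sites beta),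
        piece (beta := dims beta) M J P = q a, abs_indecomposable M
      & isomorphic M (r b)].
  have [M [J [P [gr eqN aiM]]]] := abs_indecomposable_push cb (q_ai a).
  by have [b isoM] := r_all aiM; exists b, M, J, P.
have [g gP] := choice ex_g.
have g_inj : injective g.
  move=> a a' eqg; apply: q_inj.
  have [M [J [P [gr <- aiM isoM]]]] := gP a.
  have [M' [J' [P' [gr' <- _ isoM']]]] := gP a'.
  have isoMM' : isomorphic M M'.
    by apply: isomorphic_trans isoM _; rewrite eqg; apply: isomorphic_sym.
  have [trN _] := abs_indecomposable_piece gr aiM.
  exact: (iso_pieces smallF gr gr' trN isoMM').
rewrite -[RHS]card_ord -(card_imset _ g_inj); apply: eq_card => b.
apply/graded_classesP/imsetP => [[J [P [X gr]]]|[a _ ->]].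
  have [_ aiN] := abs_indecomposable_piece gr (r_ai b).
  have [a isoN] := q_all _ aiN; exists a => //.
  have [M [J' [P' [gr' eqN _ isoM]]]] := gP a.
  apply: r_inj; apply: isomorphic_trans isoM; apply: (iso_push gr gr').
  by rewrite eqN.
have [M [J [P [gr _ _ isoM]]]] := gP a.
have [J' [P' gr']] := grading_transport isoM gr.
by exists J', P', (sites beta).
Qed.

Section Twisted.
Variables (p l : nat) (zeta : F).
Hypotheses (pF : p \in [pchar F]) (pr_l : prime l).
Hypotheses (cop : coprime p l) (nl : (n < l)%N) (prim : l.-primitive_root zeta).
Hypothesis big_l : (generic_bound A n < l)%N.
Let t := @generic_weight A F n zeta.

Lemma generic_twist_nz a : t a != 0.
Proof. exact: (generic_weight_nz _ prim). Qed.

Lemma tracial_class i : tracial vs (r i).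
Proof. exact: (abs_indecomposable_tracial supported_finite smallF (r_ai i)). Qed.

(** The dimension vector is that of the grading provided by [fixed_grading]. *)
Lemma fixed_class_graded i : isomorphic (r i) (twist t (r i)) ->
  exists2 beta, (forall x, x \in finsupp beta -> bounded n x.2) /\ compatible alpha beta
  & graded_by beta (r i).
Proof.
move=> iso_t; have wg := weight_generic prim big_l.
have [b [J [P [X [gr bX]]]]] := fixed_grading smallF pF pr_l cop nl prim generic_twist_nz
   (generic_weight_root _ prim) wg (tracial_class i) iso_t.
have b0 := grading_dim0 gr.
pose beta : cov_dimvec V A := [fsfun x in seq_fset tt (cov_seq V X) => b x.1 x.2].
have betaE j c : beta (j, c) = b j c.
  rewrite fsfunE; case: ifP => // /negbT nX; apply/esym/b0.
  apply: contra nX => cX; rewrite seq_fsetE.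
  by apply/allpairsP; exists (j, c); rewrite mem_index_enum.
exists beta.
  split.
    move=> [j c]; rewrite mem_finsupp betaE => nz /=; apply: bX.
    by apply: contraNT nz => /(b0 j) ->.
  apply/(@compatibleP _ X); first by case: gr.
    by move=> j c /(b0 j); rewrite betaE.
  by move=> j; rewrite -(grading_sum_dim gr j); apply: eq_bigr => c _; rewrite betaE.
rewrite /graded_by; have -> : (dims beta) = b; last by exists J, P, X.
apply: functional_extensionality_dep => j; apply: functional_extensionality_dep => c.
exact: betaE.
Qed.

Lemma graded_by_translate beta gamma M : translates beta gamma ->
  graded_by beta M -> graded_by gamma M.
Proof.
case=> xi e [J [P [X gr]]]; rewrite /graded_by.
have -> : dims gamma = fun i c => beta (i, c + xi).
  apply: functional_extensionality_dep => j; apply: functional_extensionality_dep => c.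
  exact: e.
have gs := grading_shift xi gr.
by exists (fun j c => J j (c + xi)), (fun j c => P j (c + xi)), [seq c - xi | c <- X].
Qed.

Lemma graded_class_fixed beta i : graded_by beta (r i) ->
  isomorphic (r i) (twist t (r i)).
Proof. by case=> J [P [X gr]]; apply: (graded_twist_iso generic_twist_nz gr). Qed.

(** The fixed classes of the twist are partitioned by the sets [graded_classes
beta], with [beta] a representative whose translation class meets the box. *)
Lemma num_classes_mod (R : set (cov_dimvec V A)) (Rs : seq (cov_dimvec V A))
    (nb : cov_dimvec V A -> nat) : representatives alpha R -> uniq Rs ->
  (forall beta, beta \in Rs -> R beta) ->
  (forall beta gamma, (forall x, x \in finsupp beta -> bounded n x.2) ->
     compatible alpha beta -> R gamma -> translates beta gamma -> gamma \in Rs) ->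
  (forall beta, R beta -> num_abs_indec cover F beta (nb beta)) ->
  m = \sum_(beta <- Rs) nb beta %[mod l] /\
  (forall beta, R beta -> beta \notin Rs -> nb beta = 0%N).
Proof.
move=> [Rcomp Rall Runiq] uRs RsR Rsall nbP.
have ex_s (i : 'I_m) : exists j, isomorphic (twist t (r i)) (r j).
  apply: r_all; apply: (tracial_abs_indecomposable supported_finite smallF).
  exact: twist_tracial generic_twist_nz (tracial_class i).
have [s sP] := choice ex_s.
have s_inj : injective s.
  move=> i j eqs; apply/r_inj/(twist_iso _ _ generic_twist_nz).
  by apply: isomorphic_trans (sP i) _; rewrite eqs; apply: isomorphic_sym.
(* The twist acts on classes through [s], and [t ^ l = 1]. *)
pose sg := perm s_inj.
have sg_l : (sg ^+ l)%g = 1%g.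
  apply/permP => i; rewrite permX perm1; apply/esym/r_inj.
  have it k : isomorphic (twist (fun a => t a ^+ k) (r i)) (r (iter k sg i)).
    elim: k => [|k IH].
      have -> : twist (fun a => t a ^+ 0) (r i) = r i; last exact: isomorphic_refl.
      by apply: functional_extensionality_dep => a; rewrite /twist expr0 scale1r.
    rewrite iterS permE; apply: isomorphic_trans (sP _).
    have -> : (fun a => t a ^+ k.+1) = (fun a => t a * t a ^+ k).
      by apply: functional_extensionality_dep => a; rewrite exprS.
    by rewrite -twist_twist; apply/twist_iso => //; exact: generic_twist_nz.
  have := it l; congr isomorphic.
  apply: functional_extensionality_dep => a.
  by rewrite /twist (generic_weight_root _ prim) scale1r.
have fixP i : (sg i == i) = `[< isomorphic (r i) (twist t (r i)) >].
  rewrite permE; apply/eqP/asboolP => [e|iso_i].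
    by apply: isomorphic_sym; have := sP i; rewrite e.
  by apply/r_inj/isomorphic_sym/(isomorphic_trans iso_i).
have graded_Rs i : sg i = i -> exists2 beta, beta \in Rs & i \in graded_classes beta.
  move/eqP; rewrite fixP => /asboolP/fixed_class_graded[b [bb cb] gb].
  have [g Rg bg] := Rall _ cb; exists g; first exact: (Rsall b).
  by apply/graded_classesP; apply: graded_by_translate bg gb.
have graded_uniq beta gamma i : R beta -> R gamma -> i \in graded_classes beta ->
    i \in graded_classes gamma -> beta = gamma.
  move=> Rb Rg /graded_classesP gb /graded_classesP gg; apply/esym/Runiq => //.
  exact: graded_by_translates (r_ai i) gb gg.
have graded_fixed beta i : i \in graded_classes beta -> sg i = i.
  move/graded_classesP=> gb; apply/eqP; rewrite fixP; apply/asboolP.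
  exact: graded_class_fixed gb.
split; last first.
  move=> beta Rb nRs; rewrite -(card_graded_classes (Rcomp _ Rb) (nbP _ Rb)).
  apply: eq_card0 => i; apply/negP => ib.
  have [g gRs ig] := graded_Rs i (graded_fixed _ _ ib).
  by move: nRs; rewrite (graded_uniq _ _ _ Rb (RsR _ gRs) ib ig) gRs.
rewrite -[in LHS](card_ord m) (card_fix_perm_mod pr_l sg_l); congr (_ %% _)%N.
transitivity (\sum_(beta <- Rs)
  \sum_(i in [set x | sg x == x]) (i \in graded_classes beta))%N.
  rewrite exchange_big -sum1_card; apply: eq_bigr => i.
  rewrite inE => /eqP/graded_Rs[b bRs ib].
  rewrite (bigD1_seq b) //= ib big_seq_cond big1 // => g /andP[gRs nbg].
  case ig: (i \in graded_classes g) => //.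
  by rewrite (graded_uniq _ _ _ (RsR _ gRs) (RsR _ bRs) ig ib) eqxx in nbg.
rewrite big_seq [RHS]big_seq; apply: eq_bigr => b bRs.
rewrite -(card_graded_classes (Rcomp _ (RsR _ bRs)) (nbP _ (RsR _ bRs))).
rewrite -big_mkcondr -sum1_card; apply: eq_bigl => i; rewrite inE.
by case ib: (i \in _); rewrite ?andbF // (graded_fixed _ _ ib) eqxx.
Qed.

End Twisted.
End Classes.
End Count.

(** * Finiteness and the identity at one *)

Section FinitelyManyShapes.
Variables (V A : finType) (alpha : V -> nat).
Local Notation lattice := {ffun A -> int}.
Local Notation n := (total_dim alpha (index_enum V)).
Implicit Types beta gamma : cov_dimvec V A.

Lemma translates_sym beta gamma : translates beta gamma -> translates gamma beta.
Proof. by case=> xi e; exists (- xi) => i c; rewrite e addrNK. Qed.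

Lemma translates_trans beta gamma delta :
  translates beta gamma -> translates gamma delta -> translates beta delta.
Proof.
by case=> xi e [xi' e']; exists (xi' + xi) => i c; rewrite e' e addrA.
Qed.

Lemma compatible_le beta x : compatible alpha beta -> (beta x <= n)%N.
Proof.
move=> cb; have [xS|/fsfun_dflt -> //] := boolP (x \in finsupp beta).
apply: (@leq_trans (alpha x.1)).
  rewrite -(cb x.1) big_mkcond (bigD1_seq x) ?fset_uniq //= eqxx.
  exact: leq_addr.
by rewrite /total_dim (bigD1 x.1) //= leq_addr.
Qed.

Let code := {ffun V * {ffun A -> 'I_(n + n).+1} -> 'I_n.+1}.

Let site (h : {ffun A -> 'I_(n + n).+1}) : lattice := [ffun a => (h a)%:Z - n%:Z].
Let index_of (c : lattice) : {ffun A -> 'I_(n + n).+1} :=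
  [ffun a => inord (absz (c a + n%:Z))].

Let decode (T : code) : cov_dimvec V A :=
  [fsfun x in seq_fset tt
      [seq (i, site h) | i <- enum V, h <- enum {: {ffun A -> 'I_(n + n).+1}}]
     => (T (x.1, index_of x.2) : nat)].

Lemma site_index c : bounded n c -> site (index_of c) = c.
Proof.
move=> bc; apply/ffunP => a; rewrite !ffunE; have := bc a.
by move: (c a) => z zn; rewrite inordK; lia.
Qed.

Lemma decode_onto beta : (forall x, x \in finsupp beta -> bounded n x.2) ->
  compatible alpha beta -> exists T, decode T = beta.
Proof.
move=> bb cb; exists [ffun y => inord (beta (y.1, site y.2))].
apply/fsfunP => -[i c]; rewrite fsfunE seq_fsetE /=.
case: ifP => [/allpairsP[[j h] /= [_ _ [_ defc]]]|nS].
  rewrite ffunE /= site_index ?inordK ?ltnS ?compatible_le // defc => a.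
  rewrite ffunE; have := ltn_ord (h a).
  by move: (nat_of_ord (h a)) => x; move: n => y; lia.
apply/esym/fsfun_dflt; move/negbT: nS; apply: contra => /bb /= bc.
by apply/allpairsP; exists (i, index_of c); rewrite /= site_index // !mem_enum.
Qed.

(** A compatible dimension vector supported in the box is described by a table of
a finite type, and each translation class contains one representative. *)
Lemma finitely_many_shapes (R : set (cov_dimvec V A)) : representatives alpha R ->
  exists Rs : seq (cov_dimvec V A), [/\ uniq Rs, forall beta, beta \in Rs -> R beta &
    forall beta gamma, (forall x, x \in finsupp beta -> bounded n x.2) ->
      compatible alpha beta -> R gamma -> translates beta gamma -> gamma \in Rs].
Proof.
move=> [_ _ Runiq].
have ex_pick (T : code) : exists o : option (cov_dimvec V A),
    (forall g, o = Some g -> R g) /\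
    (forall g, R g -> translates (decode T) g -> o = Some g).
  have [[g [Rg tg]]|none] := pselect (exists g, R g /\ translates (decode T) g).
    exists (Some g); split=> [_ [<-] //|g' Rg' tg']; congr Some.
    by apply: Runiq => //; apply: translates_trans tg'; apply: translates_sym.
  by exists None; split=> // g Rg tg; case: none; exists g.
have [pick pickP] := choice ex_pick.
exists (undup (pmap pick (enum {: code}))); split; first exact: undup_uniq.
  move=> b; rewrite mem_undup mem_pmap => /mapP[T _ /esym e].
  exact: (pickP T).1 e.
move=> b g bb cb Rg tg; have [T defb] := decode_onto bb cb.
rewrite mem_undup mem_pmap; apply/mapP; exists T; first by rewrite mem_enum.
by apply/esym/(pickP T).2; rewrite ?defb.
Qed.
End FinitelyManyShapes.

Lemma small_char_of_lt (F : finFieldType) p N : p \in [pchar F] -> (N < p)%N ->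
  small_char F N.
Proof.
move=> pF ltNp m /andP[m0 mN]; rewrite -(dvdn_pcharf pF).
by apply: contraL (leq_ltn_trans mN ltNp) => /dvdn_leq -/(_ m0); rewrite -leqNgt.
Qed.

Lemma dvdz_small (z : int) l y : (`|z| < l)%N -> z = l%:Z * y -> z = 0.
Proof.
move=> zl e; apply/eqP; rewrite -absz_eq0; apply: contraTT zl.
rewrite e abszM absz_nat -lt0n muln_gt0 => /andP[_ y0].
by rewrite -leqNgt leq_pmulr.
Qed.

Section Congruence.
Variables (V A : finType) (G : quiver V A) (alpha : V -> nat) (a_G : {poly int}).
Hypothesis ha_G : is_kac_poly G alpha a_G.
Variable R : set (cov_dimvec V A).
Hypothesis hR : representatives alpha R.
Variable a_cov : cov_dimvec V A -> {poly int}.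
Hypothesis ha_cov : forall beta, R beta ->
  is_kac_poly (covering_quiver G) beta (a_cov beta).
Variable Rs : seq (cov_dimvec V A).
Hypotheses (uRs : uniq Rs) (RsR : forall beta, beta \in Rs -> R beta).
Local Notation n := (total_dim alpha (index_enum V)).
Hypothesis Rsall : forall beta gamma, (forall x, x \in finsupp beta -> bounded n x.2) ->
  compatible alpha beta -> R gamma -> translates beta gamma -> gamma \in Rs.

(** All conditions on [l] are lower bounds, once [p] is fixed. *)
Lemma value_at_one_mod (B : nat) : exists2 l, (B < l)%N &
  (exists y, a_G.[1] - \sum_(beta <- Rs) (a_cov beta).[1] = l%:Z * y) /\
  (forall beta, R beta -> beta \notin Rs -> exists y, (a_cov beta).[1] = l%:Z * y).
Proof.
have [p np pr_p] := prime_above n.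
have [l big_l pr_l] := prime_above (B + n + p + generic_bound A n)%N.
exists l; first by lia.
have l1 := prime_gt1 pr_l.
have cop : coprime p l.
  by rewrite prime_coprime // dvdn_prime2 //; apply/eqP => e; lia.
have l0 : (0 < l.-1)%N by lia.
have [F pF cardF] := pPrimePowerField pr_p l0.
have smallF := small_char_of_lt pF np.
have q0 : (0 < #|F|)%N by rewrite cardF expn_gt0 prime_gt0.
have lq : (l %| #|F|.-1)%N.
  rewrite -subn1 -eqn_mod_dvd // cardF; have := fermat_exp 1 pr_l cop.
  by rewrite muln1 => ->; rewrite modn_small.
have [zeta prim] := prim_root_finField pr_l lq.
have [m [r [r_ai r_inj r_all]] eqm] := ha_G F.
have ex_nb beta : exists k, R beta ->
    num_abs_indec (covering_quiver G) F beta k /\ (a_cov beta).[#|F|%:Z] = k%:Z.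
  have [Rb|] := pselect (R beta); last by exists 0%N.
  by have [k hk ek] := ha_cov Rb F; exists k.
have [nb nbP] := choice ex_nb.
have [|//|eq_m nb0] := @num_classes_mod _ _ _ _ _ smallF _ _ r_ai r_inj r_all
  p l zeta pF pr_l cop _ prim _ R Rs nb hR uRs RsR Rsall (fun b Rb => (nbP b Rb).1).
- by lia.
- by lia.
have hm P := horner_int_congr P q0 lq.
split; last first.
  move=> b Rb nRs; have [y ey] := hm (a_cov b).
  exists (- y); move: ey; rewrite (nbP b Rb).2 nb0 // mulrN => /esym/eqP.
  by rewrite addr_eq0 => /eqP.
have [ym em] := hm a_G.
have [ys es] : exists y,
    \sum_(b <- Rs) (nb b)%:Z = \sum_(b <- Rs) (a_cov b).[1] + l%:Z * y.
  elim: (Rs) RsR => [|b s IH] sR; first by exists 0; rewrite !big_nil mulr0 addr0.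
  have [g gs|y ey] := IH; first by apply: sR; rewrite inE gs orbT.
  have [y' ey'] := hm (a_cov b); have Rb : R b by apply: sR; rewrite inE eqxx.
  exists (y + y'); rewrite !big_cons -(nbP b Rb).2 ey' ey mulrDr.
  by rewrite addrACA [l%:Z * y' + _]addrC.
have [yd ed] : exists y, m%:Z = \sum_(b <- Rs) (nb b)%:Z + l%:Z * y.
  have -> : \sum_(b <- Rs) (nb b)%:Z = (\sum_(b <- Rs) nb b)%N%:Z.
    by rewrite (big_morph Posz PoszD (erefl _)).
  move: (\sum_(b <- Rs) nb b)%N eq_m => k eq_m.
  exists ((m %/ l)%N%:Z - (k %/ l)%N%:Z).
  have := divn_eq m l; have := divn_eq k l; rewrite eq_m; nia.
exists (ys + yd - ym); rewrite -[LHS](addrK (l%:Z * ym)).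
have -> : a_G.[1] = m%:Z - l%:Z * ym by rewrite -eqm em addrK.
rewrite ed es; lia.
Qed.
End Congruence.

Local Open Scope classical_set_scope.

Theorem theorem1p1 (V A : finType) (G : quiver V A) (alpha : V -> nat)
    (a_G : {poly int}) (ha_G : is_kac_poly G alpha a_G)
    (R : set (cov_dimvec V A)) (hR : representatives alpha R)
    (a_cov : cov_dimvec V A -> {poly int})
    (ha_cov : forall beta, R beta ->
       is_kac_poly (covering_quiver G) beta (a_cov beta)) :
  finite_set [set beta | R beta /\ (a_cov beta).[1] != 0] /\
  a_G.[1] = \sum_(beta \in R) (a_cov beta).[1].
Proof.
have [Rs [uRs RsR Rsall]] := finitely_many_shapes hR.
have cong := value_at_one_mod ha_G hR ha_cov uRs RsR Rsall.
have zero_off beta : R beta -> beta \notin Rs -> (a_cov beta).[1] = 0.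
  move=> Rb nRs; have [l ltl [_ off]] := cong (absz (a_cov beta).[1]).
  by have [y] := off beta Rb nRs; apply: dvdz_small.
split.
  apply: sub_finite_set (finite_seq Rs) => beta [Rb nz] /=.
  by apply: contraNT nz => /(zero_off _ Rb) ->.
have -> : \sum_(beta \in R) (a_cov beta).[1] = \sum_(beta <- Rs) (a_cov beta).[1].
  rewrite [RHS]fsbig_seq //; apply/esym.
  apply: fsbig_widen => [beta /RsR //|beta [Rb nRs] /=].
  by apply: zero_off => //; apply/negP.
apply/subr0_eq; set z := _ - _; have [l ltl [[y e] _]] := cong (absz z).
exact: dvdz_small ltl e.
Qed.
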